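(* Let $\theta_1,\ldots,\theta_N$ be i.i.d. uniform on $[0,1]$, $\mathbf{V}$ the $N\times N$ random Vandermonde matrix with these phases, and $\lambda_1(N)$ the smallest eigenvalue of $\mathbf{V}^*\mathbf{V}$. Let $\gamma=\log\big(\cos(\pi/8)/\sin(\pi/8)\big)$. Then for every $\epsilon\in(0,1)$ and all sufficiently large $N$, $$\mathbb{P}\Big(\lambda_1(N)\le4N^2\exp\big(-\sqrt{\gamma\pi}\,\epsilon\sqrt N/2\big)\Big)\ge1-\epsilon.$$
   Context: The $N\times N$ Vandermonde matrix has entries $V(j,q)=\frac{1}{\sqrt N}e^{2\pi i (j-1)\theta_q}$, $j,q=1,\ldots,N$. *)

(* Defs.v *)
(* mathcomp-analysis (measure theory / probability) +
   real-closed complex numbers R[i] for the complex Vandermonde matrix. *)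
From HB Require Import structures.
From mathcomp Require Import all_boot all_order all_algebra.
From mathcomp Require Import all_classical all_reals all_analysis.
From mathcomp Require Import complex.
Set Implicit Arguments. Unset Strict Implicit. Unset Printing Implicit Defensive.
Import Order.TTheory GRing.Theory Num.Theory.
Local Open Scope classical_set_scope.
Local Open Scope ring_scope.

(* Mutual independence of a finite family of real random variables:
   the product rule over every finite subfamily J and Borel sets B_i. *)
Definition mutually_independent (R : realType) (d : measure_display)
  (T : measurableType d) (P : probability T R) (n : nat)
  (X : 'I_n -> T -> R) : Prop :=
  forall (J : {set 'I_n}) (B : 'I_n -> set R),
    (forall i, measurable (B i)) ->
    P (\bigcap_(i in [set i | i \in J]) (X i @^-1` B i)) =
    (\prod_(i in J) P (X i @^-1` B i))%E.

(* X is uniformly distributed on [0,1]. *)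
Definition uniform01 (R : realType) (d : measure_display)
  (T : measurableType d) (P : probability T R) (X : T -> R) : Prop :=
  forall B : set R, measurable B ->
    P (X @^-1` B) = (@lebesgue_measure R) (B `&` `[0%R, 1%R]%classic).

(* The N x N Vandermonde matrix V(j,q) = N^{-1/2} e^{2 pi i (j-1) theta_q}
   (indices j,q in 'I_N, so j here is the paper's j-1). *)
Definition vandermonde (R : realType) (N : nat) (theta : 'I_N -> R) :
  'M[R[i]]_N :=
  \matrix_(j < N, q < N)
    ((Num.sqrt (N%:R))^-1 * cos (2 * pi * j%:R * theta q)
     +i* ((Num.sqrt (N%:R))^-1 * sin (2 * pi * j%:R * theta q)))%C.

(* conjugate transpose *)
Definition adjmx (R : rcfType) (m n : nat) (A : 'M[R[i]]_(m, n)) :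
  'M[R[i]]_(n, m) := (map_mx (fun z => z^*) A)^T.

(* smallest eigenvalue of a matrix whose eigenvalues are real
   (e.g. V^* V, which is Hermitian): the real l such that l is an
   eigenvalue and l <= every eigenvalue. *)
Definition lambda_min (R : realType) (n : nat) (A : 'M[R[i]]_n) : R :=
  xget 0 [set l : R | eigenvalue A (l%:C)%C /\
                      forall a, eigenvalue A a -> (l%:C)%C <= a].

Definition gamma16 (R : realType) : R := ln (cos (pi / 8) / sin (pi / 8)).

(* Main.v *)
Require Import Defs.
From HB Require Import structures.
From mathcomp Require Import all_boot all_order all_algebra.
From mathcomp Require Import all_classical all_reals all_analysis.
From mathcomp Require Import measurable_realfun complex ring lra.
Set Implicit Arguments. Unset Strict Implicit. Unset Printing Implicit Defensive.
Import Order.TTheory GRing.Theory Num.Theory.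
Import Normc.
Local Open Scope classical_set_scope.
Local Open Scope ring_scope.

(** Write z_q = exp (2 pi i theta_q), S = z_1 + ... + z_N and
    P(x) = (x - z_1) ... (x - z_N).

    Deterministic part.  The polynomial P - x^N has degree < N and modulus 1 at
    every node, so its coefficient vector is a trial vector showing that
    lambda_min <= 4 N / |P(zeta)|^2 as soon as |zeta| <= 1 and |P(zeta)| >= 2.
    Averaging log |P| over the L-th roots of unity, scaled by r < 1 and rotated
    by c = - S / |S|, against the weights (1 + Re w^j) / L gives r |S| / 2 up to
    an error O(r^L): this is a discrete form of the fact that the first Taylor
    coefficient of an analytic function is controlled by the maximum of its real
    part.  Hence lambda_min <= 4 N exp (2 - |S|).

    Probabilistic part.  It remains to see that |S| <= sqrt (D N), with
    D = gamma pi eps^2 / 4, has probability less than eps.  Discretise each theta_q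
    to a grid of m points.  The mean of exp (- a |x + u|^2) over the grid points u
    of the circle is at most exp (- a) exp (- (a - a^2) |x|^2), up to a factor that
    tends to 1, so the coefficient a obeys the recursion a -> a - a^2 and
    E exp (- a |S|^2) <= exp (2 a) / (1 + a N) up to that factor.  Markov's
    inequality with a = (1 / D - 1) / N bounds the probability by
    D exp (1 - D) (1 + o(1)), which is less than eps because gamma pi e < 8. *)

Local Notation Re := (@complex.Re _).
Local Notation Im := (@complex.Im _).

(** * Complex modulus and points of the unit circle *)

(** Real-valued and polynomial in the coordinates, so identities reduce to [ring]; square roots
    enter only through [normc]. *)
Definition normsq (R : rcfType) (z : R[i]) : R := (Re z) ^+ 2 + (Im z) ^+ 2.

Definition cis (R : realType) (x : R) : R[i] := (cos x +i* sin x)%C.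

Section ComplexModulus.
Variable R : rcfType.
Implicit Types x y z : R[i].

Lemma normsq_ge0 z : 0 <= normsq z.
Proof. by rewrite addr_ge0 ?sqr_ge0. Qed.

Lemma normsqM x y : normsq (x * y) = normsq x * normsq y.
Proof. by case: x y => [a b] [c d]; rewrite /normsq /=; ring. Qed.

Lemma normsqX x n : normsq (x ^+ n) = normsq x ^+ n.
Proof.
elim: n => [|n IH]; last by rewrite !exprS normsqM IH.
by rewrite !expr0 /normsq /= expr0n addr0 expr1n.
Qed.

Lemma normsqJ x : normsq (x^*)%C = normsq x.
Proof. by case: x => [a b]; rewrite /normsq /= sqrrN. Qed.

Lemma normsqN x : normsq (- x) = normsq x.
Proof. by case: x => [a b]; rewrite /normsq /= !sqrrN. Qed.

Lemma normsqD x y :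
  normsq (x + y) = normsq x + normsq y + 2 * Re ((x^*)%C * y).
Proof. by case: x y => [a b] [c d]; rewrite /normsq /=; ring. Qed.

Lemma normsq_real (a : R) : normsq (a%:C)%C = a ^+ 2.
Proof. by rewrite /normsq /= expr0n addr0. Qed.

Lemma normsq_nat n : normsq (n%:R : R[i]) = n%:R ^+ 2.
Proof.
by rewrite -(normsq_real n%:R); congr normsq; rewrite rmorph_nat.
Qed.

Lemma mulcJ_normsq z : z * (z^*)%C = ((normsq z)%:C)%C.
Proof. by case: z => [a b]; rewrite /normsq; simpc; congr Complex => /=; ring. Qed.

Lemma normsq1 : normsq (1 : R[i]) = 1.
Proof. by rewrite (normsq_nat 1) expr1n. Qed.

Lemma normsqE z : normsq z = normc z ^+ 2.
Proof. by case: z => [a b]; rewrite /normsq /= sqr_sqrtr // addr_ge0 ?sqr_ge0. Qed.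

Lemma normc_ge0 z : 0 <= normc z.
Proof. by case: z => a b /=; rewrite sqrtr_ge0. Qed.

Lemma normcE z : normc z = Num.sqrt (normsq z).
Proof. by case: z. Qed.

Lemma normsq_eq0 z : (normsq z == 0) = (z == 0).
Proof.
case: z => a b; rewrite /normsq eq_complex /=.
by rewrite paddr_eq0 ?sqr_ge0 // !sqrf_eq0.
Qed.

Lemma normc_Re_le z : `|Re z| <= normc z.
Proof.
case: z => a b /=; rewrite -sqrtr_sqr ler_sqrt ?lerDl ?sqr_ge0 //.
by rewrite addr_ge0 ?sqr_ge0.
Qed.

Lemma Re_sum (I : Type) (r : seq I) (P : pred I) (F : I -> R[i]) :
  Re (\sum_(i <- r | P i) F i) = \sum_(i <- r | P i) Re (F i).
Proof. by elim/big_rec2: _ => //= i a b _ <-; case: (F i) b => ? ? []. Qed.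

Lemma Re_realM (a : R) z : Re ((a%:C)%C * z) = a * Re z.
Proof. by case: z => b c /=; rewrite mul0r subr0. Qed.

Lemma ReN z : Re (- z) = - Re z.
Proof. by case: z. Qed.

Lemma Re_divc y z : Re (y / z) = Re (y * (z^*)%C) / normsq z.
Proof. by case: y z => [a b] [c d]; rewrite /normsq /=; ring. Qed.

Lemma normc_sum (I : Type) (r : seq I) (P : pred I) (F : I -> R[i]) :
  normc (\sum_(i <- r | P i) F i) <= \sum_(i <- r | P i) normc (F i).
Proof.
elim/big_rec2: _ => [|i a b _ h]; first by rewrite normc0.
by rewrite (le_trans (le_normcD _ _)) // lerD2l.
Qed.

End ComplexModulus.

Section Cis.
Variable R : realType.
Implicit Types x y : R.

Lemma cisD x y : cis (x + y) = cis x * cis y.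
Proof.
by rewrite /cis cosD sinD; simpc; congr Complex; rewrite addrC.
Qed.

Lemma cis0 : cis (0 : R) = 1.
Proof. by rewrite /cis cos0 sin0. Qed.

Lemma cisMn x n : cis (n%:R * x) = cis x ^+ n.
Proof.
elim: n => [|n IH]; first by rewrite mul0r cis0 expr0.
by rewrite -natr1 mulrDl mul1r cisD IH exprSr.
Qed.

Lemma normsq_cis x : normsq (cis x) = 1.
Proof. by rewrite /normsq /= cos2Dsin2. Qed.

Lemma normc_cis x : normc (cis x) = 1.
Proof. by rewrite normcE normsq_cis sqrtr1. Qed.

Lemma cis2pi : cis (2 * pi : R) = 1.
Proof. by rewrite /cis mulr_natl cos2pi sin2pi. Qed.

(** Here cos x = 1 - 2 sin(x/2)^2, and x/2 lies in (0, pi), where the sine is positive. *)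
Lemma cis_neq1 x : 0 < x < 2 * pi -> cis x != 1.
Proof.
move=> /andP[x0 x2]; apply/eqP => -[c1 _].
have s0 : 0 < sin (x / 2).
  by apply: sin_gt0_pi; rewrite divr_gt0 //= ltr_pdivrMr // mulrC.
have e : x = (x / 2) *+ 2 by rewrite -mulr_natr divfK.
move: c1; rewrite {1}e cos_mulr2n cos2sin2 !mulr2n => h.
have : 0 < sin (x / 2) ^+ 2 by rewrite exprn_gt0.
by move: h; rewrite -[1 + 1]/(2:R); set t := sin _ ^+ 2; lra.
Qed.

Lemma cis_prim_root m : (0 < m)%N ->
  m.-primitive_root (cis (2 * pi / m%:R : R)).
Proof.
move=> m0; have m0' : 0 < m%:R :> R by rewrite ltr0n.
apply/andP; split=> //; apply/forallP => i; apply/eqP.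
rewrite unity_rootE -cisMn.
have [->|ne] := eqVneq i.+1 m.
  by rewrite mulrC divfK ?lt0r_neq0 // cis2pi eqxx.
have lt : (i.+1 < m)%N by rewrite ltn_neqAle ne ltn_ord.
apply/negbTE/cis_neq1; rewrite mulr_gt0 ?ltr0n ?divr_gt0 ?mulr_gt0 ?pi_gt0 //=.
rewrite mulrA ltr_pdivrMr // mulrC ltr_pM2l ?mulr_gt0 ?pi_gt0 //.
by rewrite ltr_nat.
Qed.

End Cis.

(** * Averages over roots of unity *)

Lemma sum_unity_root (F : fieldType) (z : F) m :
  z ^+ m = 1 -> z != 1 -> \sum_(j < m) z ^+ j = 0.
Proof.
move=> zm z1; have := subrX1 z m; rewrite zm subrr => /esym/eqP.
by rewrite mulf_eq0 subr_eq0 (negbTE z1) => /eqP.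
Qed.

Section DiscreteFourier.
Variables (R : realType) (m : nat).
Let w : R[i] := cis (2 * pi / m%:R).
Hypothesis m_gt0 : (0 < m)%N.

Lemma sum_prim_rootX k : \sum_(j < m) (w ^+ k) ^+ j = if (m %| k)%N then m%:R else 0.
Proof.
have pw := cis_prim_root R m_gt0.
case: ifPn => h.
  rewrite (eq_bigr (fun _ => 1)); first by rewrite sumr_const card_ord.
  by move: h; rewrite (prim_order_dvd pw) => /eqP wk j _; rewrite wk expr1n.
apply: sum_unity_root; first by rewrite exprAC (prim_expr_order pw) expr1n.
by rewrite -(prim_order_dvd pw).
Qed.

(** Expand each squared modulus into a double sum and sum over [j] first. A diagonal term gives the
    factor [m]; off the diagonal, w^k conj(w^l) is an m-th root of unity other than 1, so its powers
    sum to 0. *)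
Lemma parseval (a : 'I_m -> R[i]) :
  \sum_(j < m) normsq (\sum_(k < m) a k * w ^+ (j * k)) =
  m%:R * \sum_(k < m) normsq (a k).
Proof.
have pw := cis_prim_root R m_gt0.
apply: complexI; rewrite rmorphM rmorph_nat !rmorph_sum.
transitivity (\sum_(j < m) \sum_(k < m) \sum_(l < m)
    (a k * ((a l)^*)%C) * (w ^+ k * ((w ^+ l)^*)%C) ^+ j).
  apply: eq_bigr => j _; rewrite /= -mulcJ_normsq rmorph_sum mulr_suml.
  apply: eq_bigr => k _; rewrite mulr_sumr; apply: eq_bigr => l _.
  by rewrite rmorphM !rmorphXn /= mulrACA exprMn -!exprM ![(_ * j)%N]mulnC.
rewrite exchange_big mulr_sumr; apply: eq_bigr => k _ /=.
rewrite exchange_big (bigD1 k) //= [X in _ + X]big1 ?addr0 => [|l lk].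
  rewrite /= mulcJ_normsq mulcJ_normsq normsqX normsq_cis expr1n.
  under eq_bigr do rewrite expr1n mulr1.
  by rewrite sumr_const card_ord mulr_natl.
rewrite -mulr_sumr sum_unity_root ?mulr0 //.
  by rewrite exprMn -rmorphXn /= !(exprAC _ _ m) (prim_expr_order pw) !expr1n conjc1 mulr1.
apply: contra lk => /eqP h.
have : w ^+ k = w ^+ l.
  rewrite -[RHS]mul1r -h -mulrA [_ * w ^+ l]mulrC mulcJ_normsq.
  by rewrite normsqX normsq_cis expr1n mulr1.
move=> /eqP; rewrite (eq_prim_root_expr pw) !modn_small // => /eqP kl.
by apply/eqP/val_inj.
Qed.

End DiscreteFourier.

(** * Exponential moments over the m-th roots of unity *)

Lemma leq_bin_exp n k : ('C(n, k) <= n ^ k)%N.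
Proof.
apply: (@leq_trans (n ^_ k)); first by rewrite -bin_ffact leq_pmulr ?fact_gt0.
elim: k n => [|k IH] n //; rewrite ffactnS expnS leq_mul2l.
apply/orP; right; apply: leq_trans (IH _) _.
by case: k {IH} => // k; rewrite leq_exp2r // leq_pred.
Qed.

Section CircleMgf.
Variable R : realType.
Implicit Types (u t a : R) (x : R[i]).

(** The inequality 1 + y <= exp y bounds exp(2 u^2 - u) below by 1 - u + 2 u^2, and (1 + u)(1 - u +
    2 u^2) = 1 + u^2 (1 + 2 u) >= 1. *)
Lemma expR_le_1D u : - 1 / 2 <= u -> expR u <= expR (2 * u ^+ 2) * (1 + u).
Proof.
move=> hu; have h1 := expR_ge1Dx (2 * u ^+ 2 - u).
have p : 0 < 1 - u + 2 * u ^+ 2 by nra.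
have -> : expR u = expR (2 * u ^+ 2) / expR (2 * u ^+ 2 - u).
  by rewrite -expRB; congr expR; ring.
rewrite ler_pM2l ?expR_gt0 // -[_^-1]mul1r ler_pdivrMr ?expR_gt0 //.
have : (1 + u) * (1 - u + 2 * u ^+ 2) <= (1 + u) * expR (2 * u ^+ 2 - u).
  by rewrite ler_pM2l; lra.
by apply: le_trans; nra.
Qed.

(** The n-th power of the previous bound at u = t / n. It trades the exponential for a polynomial of
    degree [n], to which Parseval on m > n points applies without aliasing. *)
Lemma expR_le_1Dn n t : (0 < n)%N -> - n%:R / 2 <= t ->
  expR t <= expR (2 * t ^+ 2 / n%:R) * (1 + t / n%:R) ^+ n.
Proof.
move=> n0 ht; have n0' : 0 < n%:R :> R by rewrite ltr0n.
have hu : - 1 / 2 <= t / n%:R by rewrite ler_pdivlMr //; lra.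
have := expR_le_1D hu; move: hu; set u := t / n%:R => hu h.
have tE : t = n%:R * u by rewrite mulrC divfK ?lt0r_neq0.
have -> : 2 * t ^+ 2 / n%:R = n%:R * (2 * u ^+ 2).
  by rewrite tE; field; rewrite lt0r_neq0.
rewrite {1}tE 2!expRM_natl -exprMn.
by apply: lerXn2r => //; rewrite nnegrE ?expR_ge0 ?mulr_ge0 ?expR_ge0 //; lra.
Qed.

(** Parseval with coefficients C(n, k) s^k, whose frequencies stay distinct modulo [m] because n <
    m. Bounding one of the two factors C(n, k) by n^k leaves the binomial expansion of the
    right-hand side. *)
Lemma mean_circle_binomial m n (s : R[i]) : (n < m)%N ->
  \sum_(j < m) normsq ((1 + s * cis (2 * pi / m%:R) ^+ j) ^+ n) <=
  m%:R * (1 + n%:R * normsq s) ^+ n.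
Proof.
move=> nm; have m0 : (0 < m)%N by apply: leq_ltn_trans nm.
set w := cis _.
pose a (k : 'I_m) : R[i] := 'C(n, k)%:R * s ^+ k.
rewrite (eq_bigr (fun j : 'I_m => normsq (\sum_(k < m) a k * w ^+ (j * k)))).
  rewrite parseval // ler_pM2l ?ltr0n // exprDn.
  rewrite (big_ord_widen_cond m predT (fun i => 1 ^+ (n - i) * (n%:R * normsq s) ^+ i *+ 'C(n, i))) //.
  rewrite [leRHS]big_mkcond /=; apply: ler_sum => k _.
  rewrite /a normsqM normsqX normsq_nat expr1n mul1r.
  case: ltnP => kn; last by rewrite bin_small // expr0n mul0r.
  rewrite expr2 -mulrA -[leRHS]mulr_natl ler_wpM2l ?ler0n //.
  rewrite exprMn ler_wpM2r ?exprn_ge0 ?normsq_ge0 //.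
  rewrite -natrX ler_nat.
  exact: leq_bin_exp.
move=> j _; congr normsq; rewrite exprDn.
rewrite (big_ord_widen_cond m predT (fun i => 1 ^+ (n - i) * (s * w ^+ j) ^+ i *+ 'C(n, i))) //.
rewrite big_mkcond /=; apply: eq_bigr => k _; rewrite /a.
case: ltnP => kn; last by rewrite bin_small // !mul0r.
by rewrite expr1n mul1r -mulr_natl exprMn exprM mulrA.
Qed.

(** Expanding |x + w^j|^2 leaves a cross term exp(t_j) with t_j = -2 a Re(conj(x) w^j). For s = -a
    conj(x) / n one has 1 + t_j / n = 1 + 2 Re(s w^j) <= |1 + s w^j|^2, and the mean of the n-th
    powers is at most (1 + a^2 |x|^2 / n)^n <= exp(a^2 |x|^2). *)
Lemma circle_mgf_le m n x a : (0 < n < m)%N -> 0 <= a ->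
  16 * a ^+ 2 * normsq x <= n%:R ^+ 2 ->
  \sum_(j < m) expR (- a * normsq (x + cis (2 * pi / m%:R) ^+ j)) <=
  m%:R * expR (8 * a ^+ 2 * normsq x / n%:R) * expR (- a) *
    expR (- (a - a ^+ 2) * normsq x).
Proof.
move=> /andP[n0 nm] a0 hx; set w := cis _.
have n0' : 0 < n%:R :> R by rewrite ltr0n.
pose t (j : 'I_m) := - (2 * a) * Re ((x^*)%C * w ^+ j).
have nw (j : 'I_m) : normsq (w ^+ j) = 1 by rewrite normsqX normsq_cis expr1n.
have t2 j : t j ^+ 2 <= 4 * a ^+ 2 * normsq x.
  rewrite /t exprMn sqrrN exprMn -[2 ^+ 2]/(2 * 2) -natrM ler_wpM2l ?mulr_ge0 ?sqr_ge0 //.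
  have := normsqM (x^*)%C (w ^+ j); rewrite normsqJ nw mulr1 => <-.
  by rewrite lerDl sqr_ge0.
pose s : R[i] := ((- a / n%:R)%:C)%C * (x^*)%C.
have step j : expR (t j) <= expR (8 * a ^+ 2 * normsq x / n%:R) *
    normsq ((1 + s * w ^+ j) ^+ n).
  (* The hypothesis 16 a^2 |x|^2 <= n^2 says exactly that 2 a |x| <= n / 2. *)
  have ht : - n%:R / 2 <= t j.
    have : t j ^+ 2 <= (n%:R / 2) ^+ 2 by have := t2 j; nra.
    rewrite -ler_sqrt ?sqr_ge0 // !sqrtr_sqr (ger0_norm (_ : 0 <= n%:R / 2)) ?divr_ge0 ?ler0n // ler_norml => /andP[].
    by rewrite mulNr.
  apply: le_trans (expR_le_1Dn n0 ht) _.
  apply: ler_pM; rewrite ?expR_ge0 ?exprn_ge0 //.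
  - by rewrite addrC -lerBlDr sub0r ler_pdivlMr //; lra.
  - by rewrite ler_expR ler_pM2r ?invr_gt0 //; have := t2 j; lra.
  rewrite normsqX; apply: lerXn2r; rewrite ?nnegrE ?normsq_ge0 //.
    by rewrite addrC -lerBlDr sub0r ler_pdivlMr //; lra.
  rewrite normsqD conjc1 mul1r /s -mulrA Re_realM /t.
  have -> : normsq (1 : R[i]) = 1 by rewrite (normsq_nat R 1) expr1n.
  have := normsq_ge0 (s * w ^+ j); set q := normsq _ => q0.
  rewrite -addrA lerD2l.
  have -> : 2 * (- a / n%:R * Re ((x^*)%C * w ^+ j)) = - (2 * a) * Re ((x^*)%C * w ^+ j) / n%:R by ring.
  by rewrite lerDr normsq_ge0.
have -> : \sum_(j < m) expR (- a * normsq (x + w ^+ j)) =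
    expR (- a * normsq x) * expR (- a) * \sum_(j < m) expR (t j).
  rewrite mulr_sumr; apply: eq_bigr => j _; rewrite -!expRD; congr expR.
  by rewrite normsqD nw /t; ring.
have hs : \sum_(j < m) expR (t j) <= m%:R * expR (8 * a ^+ 2 * normsq x / n%:R) * expR (a ^+ 2 * normsq x).
  apply: le_trans (ler_sum _ (fun j _ => step j)) _.
  rewrite -mulr_sumr; set E := expR (8 * _ * _ / _).
  rewrite [m%:R * E]mulrC -[leRHS]mulrA ler_wpM2l ?expR_ge0 //.
  apply: le_trans (mean_circle_binomial s nm) _.
  rewrite ler_wpM2l ?ler0n //.
  have -> : a ^+ 2 * normsq x = n%:R * (n%:R * normsq s).
    by rewrite /s normsqM normsqJ normsq_real; field; rewrite lt0r_neq0.
  rewrite expRM_natl; apply: lerXn2r; rewrite ?nnegrE ?expR_ge0 ?expR_ge1Dx //.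
  by rewrite addr_ge0 ?mulr_ge0 ?normsq_ge0 ?ler0n.
apply: le_trans (ler_wpM2l _ hs) _; first by rewrite mulr_ge0 ?expR_ge0.
have -> : expR (- (a - a ^+ 2) * normsq x) = expR (- a * normsq x) * expR (a ^+ 2 * normsq x).
  by rewrite -expRD; congr expR; ring.
by rewrite le_eqVlt; apply/orP; left; apply/eqP; ring.
Qed.

End CircleMgf.

(** * The random walk on a grid of the circle *)

Section GridWalk.
Variables (R : realType) (m : nat).
Implicit Types (a : R) (k : nat).
Let w : R[i] := cis (2 * pi / m%:R).

Definition grid_sum k (f : {ffun 'I_k -> 'I_m}) : R[i] :=
  \sum_(q < k) cis (2 * pi / m%:R) ^+ f q.

Lemma normc_grid_sum k (f : {ffun 'I_k -> 'I_m}) : normc (grid_sum f) <= k%:R.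
Proof.
apply: le_trans (normc_sum _ _ _) _.
rewrite (eq_bigr (fun _ => 1)); first by rewrite sumr_const card_ord.
by move=> q _; rewrite -cisMn normc_cis.
Qed.

Definition ffun_rcons (T : Type) k (p : {ffun 'I_k -> T} * T) : {ffun 'I_k.+1 -> T} :=
  [ffun i => if unlift ord_max i is Some j then p.1 j else p.2].

(** Separates the last step of a walk from the earlier ones, so that it can be averaged first. *)
Lemma big_ffun_rcons (T : finType) k (F : {ffun 'I_k.+1 -> T} -> R) :
  \sum_f F f = \sum_f \sum_t F (ffun_rcons (f, t)).
Proof.
rewrite pair_big /=.
rewrite (reindex (@ffun_rcons T k)) /=; last first.
  exists (fun f => ([ffun j => f (lift ord_max j)], f ord_max)) => [[f t]|f] _ /=.
    congr pair; last by rewrite ffunE unlift_none.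
    by apply/ffunP => j; rewrite !ffunE liftK.
  apply/ffunP => i; rewrite ffunE.
  by case: unliftP => [j ->|->] //=; rewrite ffunE.
by apply: eq_bigr => -[f t].
Qed.

Lemma grid_sum_rcons k (f : {ffun 'I_k -> 'I_m}) j :
  grid_sum (ffun_rcons (f, j)) = grid_sum f + w ^+ j.
Proof.
rewrite /grid_sum big_ord_recr /=; congr (_ + _).
  apply: eq_bigr => q _; rewrite ffunE.
  have -> : widen_ord (leqnSn k) q = lift ord_max q.
    by apply: val_inj; rewrite /= /bump leqNgt ltn_ord.
  by rewrite liftK.
by rewrite ffunE unlift_none.
Qed.

(** By [expR_le_1D] at -a, exp(- a - 2 a^2) <= 1 - a; moreover (1 - a)(1 + a (k + 1)) = 1 + (a -
    a^2) k - a^2. *)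
Lemma walk_recursion a k : 0 <= a <= 1 / 2 ->
  expR (- a + 2 * (a - a ^+ 2)) / (1 + (a - a ^+ 2) * k%:R) <=
  expR (2 * a) / (1 + a * k.+1%:R).
Proof.
move=> /andP[a0 a1]; have k0 : 0 <= k%:R :> R by rewrite ler0n.
have p1 : 0 < 1 + (a - a ^+ 2) * k%:R.
  by rewrite ltr_wpDr // mulr_ge0 //; nra.
have p2 : 0 < 1 + a * k.+1%:R by rewrite ltr_wpDr // mulr_ge0 ?ler0n.
have h1 : expR (- a + 2 * (a - a ^+ 2)) <= expR (2 * a) * (1 - a).
  have := @expR_le_1D R (- a) _; rewrite sqrrN => h.
  have -> : - a + 2 * (a - a ^+ 2) = 2 * a + (- a - 2 * a ^+ 2) by ring.
  rewrite expRD ler_wpM2l ?expR_ge0 // expRB ler_pdivrMr ?expR_gt0 // mulrC.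
  by apply: h; lra.
rewrite ler_pdivrMr // mulrAC ler_pdivlMr //.
apply: le_trans (ler_wpM2r (ltW p2) h1) _.
rewrite -mulrA ler_wpM2l ?expR_ge0 // -natr1.
by nra.
Qed.

(** Induction on [k] with [a] general: averaging the last step by [circle_mgf_le] replaces a by a -
    a^2, and [walk_recursion] closes the step. The fixed bound [K] on the length controls every
    partial sum, and the error factor at a dominates the one at a - a^2. *)
Lemma walk_laplace_le n K a k : (0 < n < m)%N -> (k <= K)%N ->
  0 <= a <= 1 / 2 -> 16 * a ^+ 2 * K%:R ^+ 2 <= n%:R ^+ 2 ->
  \sum_(f : {ffun 'I_k -> 'I_m}) expR (- a * normsq (grid_sum f)) <=
  m%:R ^+ k * expR (8 * a ^+ 2 * K%:R ^+ 2 / n%:R) ^+ k *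
    (expR (2 * a) / (1 + a * k%:R)).
Proof.
move=> nm; have n0 : 0 < n%:R :> R by rewrite ltr0n; case/andP: nm.
elim: k a => [|k IH] a kK /andP[a0 a1] ha.
  rewrite !expr0 !mul1r mulr0 addr0 divr1.
  apply: (@le_trans _ _ (\sum_(f : {ffun 'I_0 -> 'I_m}) 1)).
    by apply: ler_sum => f _; rewrite -expR0 ler_expR mulNr oppr_le0 mulr_ge0 ?normsq_ge0.
  rewrite sumr_const card_ffun !card_ord expn0 mulr1n -[leLHS]expR0 ler_expR; lra.
have xk (f : {ffun 'I_k -> 'I_m}) : normsq (grid_sum f) <= K%:R ^+ 2.
  rewrite normsqE; apply: lerXn2r; rewrite ?nnegrE ?normc_ge0 ?ler0n //.
  by apply: le_trans (normc_grid_sum _) _; rewrite ler_nat ltnW.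
set E := expR (8 * a ^+ 2 * K%:R ^+ 2 / n%:R).
have a' : 0 <= a - a ^+ 2 <= 1 / 2 by apply/andP; split; nra.
have aa : (a - a ^+ 2) ^+ 2 <= a ^+ 2.
  by apply: lerXn2r; rewrite ?nnegrE; nra.
rewrite big_ffun_rcons.
apply: (@le_trans _ _ (\sum_(f : {ffun 'I_k -> 'I_m})
   m%:R * E * expR (- a) * expR (- (a - a ^+ 2) * normsq (grid_sum f)))).
  apply: ler_sum => f _.
  under eq_bigr do rewrite grid_sum_rcons.
  apply: le_trans (circle_mgf_le nm a0 _) _.
    apply: le_trans ha; rewrite ler_wpM2l ?xk //.
    by rewrite mulr_ge0 ?sqr_ge0.
  rewrite ler_wpM2r ?expR_ge0 // ler_wpM2r ?expR_ge0 // ler_wpM2l ?ler0n //.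
  by rewrite ler_expR ler_pM2r ?invr_gt0 // ler_wpM2l ?mulr_ge0 ?sqr_ge0.
rewrite -mulr_sumr.
have pE : 0 <= m%:R * E * expR (- a) by rewrite !mulr_ge0 ?expR_ge0 ?ler0n.
have hh : 16 * (a - a ^+ 2) ^+ 2 * K%:R ^+ 2 <= n%:R ^+ 2.
  by apply: le_trans ha; rewrite ler_wpM2r ?sqr_ge0 // ler_wpM2l.
apply: le_trans (ler_wpM2l pE (IH _ (ltnW kK) a' hh)) _.
have hE : expR (8 * (a - a ^+ 2) ^+ 2 * K%:R ^+ 2 / n%:R) ^+ k <= E ^+ k.
  apply: lerXn2r; rewrite ?nnegrE ?expR_ge0 // ler_expR.
  by rewrite ler_pM2r ?invr_gt0 // ler_wpM2r ?sqr_ge0 // ler_wpM2l.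
have := walk_recursion k (introT andP (conj a0 a1)); rewrite expRD => hw.
have p1 : 0 < 1 + (a - a ^+ 2) * k%:R.
  by rewrite ltr_wpDr // mulr_ge0 ?ler0n //; case/andP: a'.
apply: (@le_trans _ _ (m%:R ^+ k.+1 * E * (E ^+ k) *
  (expR (- a) * expR (2 * (a - a ^+ 2)) / (1 + (a - a ^+ 2) * k%:R)))).
  have -> : forall x, m%:R * E * expR (- a) * (m%:R ^+ k * x *
     (expR (2 * (a - a ^+ 2)) / (1 + (a - a ^+ 2) * k%:R))) =
     m%:R ^+ k.+1 * E * x * (expR (- a) * expR (2 * (a - a ^+ 2)) / (1 + (a - a ^+ 2) * k%:R)).
    move=> x; rewrite [m%:R ^+ k.+1]exprS.
    move: (_^-1) (expR (- a)) (expR (2 * (a - a ^+ 2))) (m%:R ^+ k) (E) => u v y z E'.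
    by ring.
  rewrite ler_wpM2r //.
    by rewrite divr_ge0 ?mulr_ge0 ?expR_ge0 // ltW.
  by rewrite ler_wpM2l // mulr_ge0 ?exprn_ge0 ?expR_ge0 ?ler0n.
rewrite -(mulrA (_ ^+ _) E) -exprS ler_wpM2l //.
by rewrite mulr_ge0 ?exprn_ge0 ?expR_ge0 ?ler0n.
Qed.

(** Markov's inequality: each counted walk contributes at least 1 to the sum of exp(a (r -
    |S|^2)). *)
Lemma small_grid_sum_card n k a r : (0 < n < m)%N ->
  0 <= a <= 1 / 2 -> 16 * a ^+ 2 * k%:R ^+ 2 <= n%:R ^+ 2 ->
  #|[pred f : {ffun 'I_k -> 'I_m} | normsq (grid_sum f) <= r]|%:R <=
  m%:R ^+ k * (expR (8 * a ^+ 2 * k%:R ^+ 2 / n%:R * k%:R + 2 * a + a * r)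
    / (1 + a * k%:R)).
Proof.
move=> nm ha hn; have := walk_laplace_le nm (leqnn k) ha hn => h.
case/andP: ha => a0 _.
rewrite -sum1_card natr_sum.
apply: (@le_trans _ _ (expR (a * r) *
  \sum_(f : {ffun 'I_k -> 'I_m}) expR (- a * normsq (grid_sum f)))).
  rewrite mulr_sumr big_mkcond /=; apply: ler_sum => f _.
  rewrite -expRD inE; case: ifP => [hf|_]; last exact: expR_ge0.
  by rewrite -expR0 ler_expR mulNr -mulrBr mulr_ge0 // subr_ge0.
apply: le_trans (ler_wpM2l (expR_ge0 _) h) _.
rewrite -expRM_natr !expRD le_eqVlt; apply/orP; left; apply/eqP; ring.
Qed.

End GridWalk.

(** * A weighted average of log |1 - r a w^j| *)

Section WeightedLog.
Variables (R : realType) (L : nat).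
Hypothesis L_gt2 : (2 < L)%N.
Let w : R[i] := cis (2 * pi / L%:R).
Implicit Types (s c : R) (a : R[i]).

(** A nonnegative density on the L-th roots of unity with only the frequencies -1, 0, 1. Averaging a
    power series against it isolates the constant and the first coefficient, up to aliasing. *)
Definition circle_weight (j : nat) : R := (1 + Re (cis (2 * pi / L%:R) ^+ j)) / L%:R.

Lemma circle_weight_ge0 j : 0 <= circle_weight j.
Proof.
rewrite divr_ge0 ?ler0n // -lerBlDl sub0r.
have : `|Re (w ^+ j)| <= 1.
  by rewrite (le_trans (normc_Re_le _)) // -cisMn normc_cis.
by rewrite ler_norml => /andP[].
Qed.

Let L_gt0 : (0 < L)%N. Proof. by apply: leq_trans L_gt2. Qed.

(** Since conj(w) = w^(L-1), the weight mixes the frequencies 0, 1 and L - 1, and three sums over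
    roots of unity remain. *)
Lemma sum_circle_weightX k : \sum_(j < L) ((circle_weight j)%:C)%C * (w ^+ k) ^+ j =
  (L %| k)%:R + ((L %| k.+1)%:R + (L %| k + L.-1)%:R) / 2.
Proof.
have L0 : (L%:R : R[i]) != 0 by rewrite pnatr_eq0 -lt0n.
have wV j : ((w ^+ j)^*)%C = (w ^+ L.-1) ^+ j.
  rewrite rmorphXn /=; congr (_ ^+ _).
  have e : w * (w^*)%C = 1 by rewrite mulcJ_normsq normsq_cis.
  rewrite -[LHS]mul1r -(prim_expr_order (cis_prim_root R L_gt0)) -/w.
  by rewrite -[in w ^+ L](prednK L_gt0) exprSr -mulrA e mulr1.
have E j : ((circle_weight j)%:C)%C = (1 + (w ^+ j + (w ^+ L.-1) ^+ j) / 2) / L%:R.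
  rewrite -wV addcJ mulrAC divff ?pnatr_eq0 // mul1r.
  by rewrite /circle_weight rmorphM /= fmorphV rmorphD rmorph1 rmorph_nat.
have T j : ((circle_weight j)%:C)%C * (w ^+ k) ^+ j =
    ((w ^+ k) ^+ j + ((w ^+ k.+1) ^+ j + (w ^+ (k + L.-1)) ^+ j) / 2) / L%:R.
  rewrite E exprS exprD !exprMn; move: (w ^+ j) ((w ^+ L.-1) ^+ j) ((w ^+ k) ^+ j).
  by move=> x y z; field; rewrite L0.
under eq_bigr => j _ do rewrite T.
rewrite -mulr_suml big_split /= -mulr_suml big_split /= !sum_prim_rootX //.
have F b : (if b then L%:R else 0) = L%:R * b%:R :> R[i].
  by case: b; rewrite ?mulr1 ?mulr0.
by rewrite !F; field.
Qed.

(** The function z / (1 - s z) is minus the derivative of log(1 - s z) in s, so this sum controls a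
    derivative in [weighted_log_ge]. As (a w^j)^L = a^L for every [j], the common factor D = 1 - s^L
    a^L turns all the quotients into finite geometric sums. *)
Lemma sum_circle_weight_geom a s : normsq a = 1 -> 0 <= s < 1 ->
  \sum_(j < L) circle_weight j * Re (a * w ^+ j / (1 - (s%:C)%C * (a * w ^+ j)))
    <= Re a / 2 + 2 * s ^+ (L - 2) / (1 - s).
Proof.
move=> a1 /andP[s0 s1].
have L0 : (0 < L)%N by [].
have sL : s ^+ L <= s.
  by rewrite -[leRHS]expr1; apply: ler_wiXn2l => //; apply: ltW.
have na n : normc (a ^+ n) = 1 by rewrite normcE normsqX a1 expr1n sqrtr1.
have ns n : normc ((s%:C)%C ^+ n) = s ^+ n.
  by rewrite normcE normsqX normsq_real exprAC sqrtr_sqr ger0_norm ?exprn_ge0.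
have sub1 (z : R[i]) : normc z < 1 -> 1 - normc z <= normc (1 - z).
  move=> _; rewrite lerBlDr; have := le_normcD (1 - z) z.
  by rewrite subrK normc1.
have nz (z : R[i]) : normc z < 1 -> 1 - z != 0.
  by move=> h; apply/eqP => e; have := sub1 _ h; rewrite e normc0; lra.
set S := \sum_(j < L) _.
set D := 1 - (s%:C)%C ^+ L * a ^+ L.
have nsa : normc ((s%:C)%C ^+ L * a ^+ L) = s ^+ L by rewrite normcM ns na mulr1.
have D0 : D != 0 by apply: nz; rewrite nsa; lra.
pose G := \sum_(j < L) ((circle_weight j)%:C)%C * (a * w ^+ j / (1 - (s%:C)%C * (a * w ^+ j))).
have SG : S = Re G by rewrite Re_sum; apply: eq_bigr => j _; rewrite Re_realM.
have GE : D * G = \sum_(k < L) (s%:C)%C ^+ k * a ^+ k.+1 *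
    \sum_(j < L) ((circle_weight j)%:C)%C * (w ^+ k.+1) ^+ j.
  under [RHS]eq_bigr do rewrite mulr_sumr.
  rewrite exchange_big mulr_sumr; apply: eq_bigr => j _ /=.
  have nsb : normc ((s%:C)%C * (a * w ^+ j)) < 1.
    rewrite !normcM -[(s%:C)%C]expr1 ns expr1 -[a]expr1 na mul1r -cisMn normc_cis mulr1 //.
  set b := a * w ^+ j in nsb *.
  have bL : b ^+ L = a ^+ L.
    by rewrite exprMn -exprM mulnC exprM (prim_expr_order (cis_prim_root R L_gt0)) expr1n mulr1.
  have -> : D = (1 - (s%:C)%C * b) * \sum_(k < L) ((s%:C)%C * b) ^+ k.
    rewrite /D -bL -exprMn; apply: oppr_inj.
    by rewrite opprB subrX1 -mulNr opprB.
  have := nz _ nsb; set u := 1 - _ => u0.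
  rewrite (_ : forall T p, u * T * (p * (b / u)) = p * b * T); last first.
    by move=> T p; field.
  rewrite mulr_sumr; apply: eq_bigr => k _.
  have -> : (w ^+ k.+1) ^+ j = (w ^+ j) ^+ k.+1 by rewrite exprAC.
  rewrite /b !exprMn !exprS; move: (w ^+ j) => z.
  by move: (a ^+ k) (z ^+ k) ((s%:C)%C ^+ k) => ? ? ?; ring.
(* The weights keep only the terms k = 0, L - 2 and L - 1, which are distinct because L > 2. The
   first gives a / 2, the other two are error. *)
have {}GE : D * G = a / 2 + (s%:C)%C ^+ (L - 2) * a ^+ L.-1 / 2 + (s%:C)%C ^+ L.-1 * a ^+ L.
  rewrite GE; under eq_bigr do rewrite sum_circle_weightX.
  case: (L) L_gt2 => [//|[//|[//|n]]] _.
  rewrite big_ord_recl !big_ord_recr /= big1 ?add0r => [|i _]; last first.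
    rewrite /= /bump !add1n [(i.+2 + n.+2)%N](addSnnS i.+1) dvdn_addl //.
    by rewrite !gtnNdvd ?ltnS ?ltn_ord // ?(ltnW (ltn_ord _)) ?(leqW (ltnW (ltn_ord _))) // add0r addr0 mul0r mulr0.
  have e3 : (n.+3 %| n.+2 + n.+2)%N = false.
    by rewrite addSnnS dvdn_addl // gtnNdvd.
  have e4 : (n.+3 %| n.+4)%N = false by rewrite -[n.+4]addn1 dvdn_addr // gtnNdvd.
  have e5 : (n.+3 %| n.+3 + n.+2)%N = false by rewrite dvdn_addr // gtnNdvd.
  rewrite /= /bump !add1n e3 e4 e5 !dvdnn gtnNdvd // expr0 expr1 subn2 /=.
  by move: (_ ^+ n.+1) (_ ^+ n.+2) (_ ^+ n.+2) (_ ^+ n.+3) => ? ? ? ?; field.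
set e := G - a / 2.
have De : D * e =
    (s%:C)%C ^+ (L - 2) * a ^+ L.-1 / 2 + (s%:C)%C ^+ L.-1 * a ^+ L + (s%:C)%C ^+ L * a ^+ L.+1 / 2.
  by rewrite mulrBr GE /D exprS; move: (a ^+ L) => ?; ring.
have sL1 : s ^+ L.-1 <= s ^+ (L - 2) /\ s ^+ L <= s ^+ (L - 2).
  by split; apply: ler_wiXn2l => //; rewrite ?(ltW s1) // -?subn1 ?leq_sub2l ?leq_subr.
have n2 : normc (2^-1 : R[i]) = 2^-1.
  by rewrite normcV -[2]/(2%:R) normcE normsq_nat sqrtr_sqr ger0_norm.
have nDe : normc D * normc e <= 2 * s ^+ (L - 2).
  rewrite -normcM De; apply: le_trans (le_normcD _ _) _.
  apply: le_trans (lerD (le_normcD _ _) (lexx _)) _.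
  rewrite !normcM !ns !na n2; case: sL1; lra.
have nD : 1 - s <= normc D.
  have := sub1 ((s%:C)%C ^+ L * a ^+ L); rewrite nsa => /(_ (le_lt_trans sL s1)).
  by rewrite -/D; lra.
have ne : normc e <= 2 * s ^+ (L - 2) / (1 - s).
  rewrite ler_pdivlMr ?subr_gt0 // (le_trans _ nDe) // mulrC ler_wpM2r ?normc_ge0 //.
have : Re e <= normc e by apply: le_trans (ler_norm _) (normc_Re_le _).
have -> : Re e = S - Re a / 2.
  rewrite SG /e; rewrite (_ : (2 : R[i])^-1 = ((2^-1)%:C)%C) ?fmorphV ?rmorph_nat //.
  by case: (G) (a) => g1 g2 [x y] /=; field.
lra.
Qed.

Lemma is_derive_log_quad c s : 0 < 1 - 2 * s * c + s ^+ 2 ->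
  is_derive s 1 (fun x : R => ln (1 - 2 * x * c + x ^+ 2))
    ((2 * s - 2 * c) / (1 - 2 * s * c + s ^+ 2)).
Proof.
move=> p.
have d1 : is_derive s 1 (fun x : R => 1 - 2 * x * c + x ^+ 2) (2 * s - 2 * c).
  have -> : (fun x : R => 1 - 2 * x * c + x ^+ 2) = cst 1 + (- (2 * c)) *: (id : R -> R) + (id : R -> R) ^+ 2.
    by apply/funext => x /=; rewrite -[LHS]/(1 - 2 * x * c + x ^+ 2) -[RHS]/(1 + - (2 * c) * x + x ^+ 2); ring.
  by apply: is_derive_eq; rewrite /GRing.scale /= expr1; ring.
have := @is_derive1_comp R (@ln R) (fun x : R => 1 - 2 * x * c + x ^+ 2) s _ _ (is_derive1_ln p) d1.
by move=> h; apply: is_derive_eq; rewrite mulrC.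
Qed.

(** The sum vanishes at r = 0, and its derivative at s is -2 times the sum of
    [sum_circle_weight_geom]. The mean value theorem on [0, r] concludes: the error term increases
    with s, so its value at r dominates. *)
Lemma weighted_log_ge a r : normsq a = 1 -> 0 <= r < 1 ->
  - (r * Re a) - 4 * r ^+ (L - 2) / (1 - r) <=
  \sum_(j < L) circle_weight j * ln (normsq (1 - (r%:C)%C * (a * w ^+ j))).
Proof.
move=> a1 /andP[r0 r1].
have nb j : normsq (a * w ^+ j) = 1 by rewrite normsqM a1 normsqX normsq_cis expr1n mulr1.
have q s j : normsq (1 - (s%:C)%C * (a * w ^+ j)) = 1 - 2 * s * Re (a * w ^+ j) + s ^+ 2.
  rewrite normsqD conjc1 mul1r normsqN normsqM nb normsq1 normsq_real.
  by rewrite ReN Re_realM; ring.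
have pos s j : 0 <= s < 1 -> 0 < 1 - 2 * s * Re (a * w ^+ j) + s ^+ 2.
  move=> /andP[s0 s1]; have := le_trans (ler_norm _) (normc_Re_le (a * w ^+ j)).
  by rewrite normcE nb sqrtr1; nra.
pose F s := \sum_(j < L) circle_weight j * ln (1 - 2 * s * Re (a * w ^+ j) + s ^+ 2).
pose dF s := \sum_(j < L) circle_weight j *
  ((2 * s - 2 * Re (a * w ^+ j)) / (1 - 2 * s * Re (a * w ^+ j) + s ^+ 2)).
have dFP s : 0 <= s < 1 -> is_derive s 1 F (dF s).
  move=> hs.
  have -> : F = \sum_(j < L) (fun s => circle_weight j * ln (1 - 2 * s * Re (a * w ^+ j) + s ^+ 2)).
    by apply/funext => x; rewrite fct_sumE.
  apply: is_derive_sum => j.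
  exact: is_deriveZ (is_derive_log_quad (pos _ _ hs)).
have dFE s : 0 <= s < 1 -> dF s =
    - 2 * \sum_(j < L) circle_weight j * Re (a * w ^+ j / (1 - (s%:C)%C * (a * w ^+ j))).
  move=> hs; rewrite mulr_sumr; apply: eq_bigr => j _; rewrite [RHS]mulrCA; congr (_ * _).
  have := pos s j hs; rewrite Re_divc q; have := nb j.
  move: (a * w ^+ j) => [x y]; rewrite /normsq /= => xy p.
  have -> : x * (1 - (s * x - 0 * y)) - y * - (0 - (s * y + 0 * x)) = x - s * (x ^+ 2 + y ^+ 2).
    by ring.
  by rewrite xy; field; rewrite lt0r_neq0.
have F0 : F 0 = 0.
  by rewrite /F big1 // => j _; rewrite mulr0 mul0r subr0 expr0n addr0 ln1 mulr0.
under eq_bigr do rewrite q.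
rewrite -/(F r).
(* The mean value theorem is applied on a nondegenerate interval, so r = 0 is treated apart. *)
have [->|r0'] := eqVneq r 0.
  by rewrite F0 mul0r oppr0 sub0r oppr_le0 addr0 divr1 mulr_ge0 ?exprn_ge0.
have rp : 0 < r by rewrite lt_def r0'.
have itv x : x \in `[0, r]%R -> 0 <= x < 1.
  by rewrite in_itv /= => /andP[-> xr]; rewrite (le_lt_trans xr).
have d1 x : x \in `]0, r[%R -> is_derive x 1 F (dF x).
  by move=> h; apply/dFP/itv; exact: subset_itv_oo_cc.
have cF : {within `[0, r], continuous F}.
  apply: derivable_within_continuous => x /itv hx.
  by apply: ex_derive; exact: dFP.
have [c cr] := MVT rp d1 cF.
have hc : 0 <= c < 1 by apply: itv; exact: subset_itv_oo_cc.
have := sum_circle_weight_geom a1 hc; rewrite F0 subr0 (dFE _ hc).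
set S := \sum_(j < L) _ => hS ->; rewrite subr0.
have {}cr : c <= r by move: cr; rewrite in_itv /= => /andP[_ /ltW].
have h : 2 * c ^+ (L - 2) / (1 - c) <= 2 * r ^+ (L - 2) / (1 - r).
  case/andP: hc => c0 c1; rewrite -!mulrA ler_wpM2l // ler_pM ?exprn_ge0 ?invr_ge0 //; try lra.
    by apply: lerXn2r; rewrite ?nnegrE.
  by rewrite lef_pV2 ?posrE; lra.
set e := 2 * r ^+ (L - 2) / (1 - r) in h.
have e0 : 0 <= e by rewrite divr_ge0 ?mulr_ge0 ?exprn_ge0 //; lra.
have -> : 4 * r ^+ (L - 2) / (1 - r) = 2 * e by rewrite /e; ring.
by nra.
Qed.

End WeightedLog.

(** * Smallest eigenvalue of a Gram matrix *)

Lemma seq_min_exists d (T : orderType d) (s : seq T) (x : T) : x \in s ->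
  exists2 m, m \in s & forall y, y \in s -> (m <= y)%O.
Proof.
elim: s x => // y s IH x _; case: s IH => [|z s] IH.
  by exists y; rewrite ?mem_head // => t; rewrite inE => /eqP ->.
have [m ms hm] := IH z (mem_head _ _).
have [ym|my] := leP y m.
  exists y; rewrite ?mem_head // => t; rewrite inE => /predU1P[->//|/hm].
  exact: le_trans.
exists m; first by rewrite inE ms orbT.
by move=> t; rewrite inE => /predU1P[->|/hm //]; apply: ltW.
Qed.

Lemma eigenvalue0_unit (F : fieldType) n (A : 'M[F]_n) :
  eigenvalue A 0 = (A \notin unitmx).
Proof.
by rewrite /eigenvalue /eigenspace raddf0 subr0 kermx_eq0 row_free_unit.
Qed.

(** For a = 0 both products are singular together; otherwise v A is an eigenvector of B A, nonzero
    because a v is. This passes from [A *m adjmx A], suited to row trial vectors, to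
    [adjmx A *m A]. *)
Lemma eigenvalue_mulmxC (F : fieldType) n (A B : 'M[F]_n) a :
  eigenvalue (A *m B) a -> eigenvalue (B *m A) a.
Proof.
have [->|a0] := eqVneq a 0.
  by rewrite !eigenvalue0_unit !unitmx_mul andbC.
move=> /eigenvalueP[v vAB v0]; apply/eigenvalueP; exists (v *m A).
  by rewrite !mulmxA -(mulmxA v) vAB scalemxAl.
apply: contra v0 => /eqP vA; move: vAB; rewrite mulmxA vA mul0mx => /esym/eqP.
by rewrite scaler_eq0 (negbTE a0).
Qed.

Section GramMatrix.
Variable R : realType.
Implicit Types (n : nat).

Definition rownormsq n (v : 'rV[R[i]]_n) : R := \sum_(q < n) normsq (v 0 q).

Lemma rownormsq_ge0 n (v : 'rV[R[i]]_n) : 0 <= rownormsq v.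
Proof. by apply: sumr_ge0 => q _; apply: normsq_ge0. Qed.

Lemma rownormsq_eq0 n (v : 'rV[R[i]]_n) : (rownormsq v == 0) = (v == 0).
Proof.
apply/idP/eqP => [|->]; last first.
  by rewrite /rownormsq big1 // => q _; rewrite mxE /normsq /= expr0n addr0.
rewrite psumr_eq0 => [/allP h|q _]; last exact: normsq_ge0.
apply/rowP => q; rewrite mxE; apply/eqP; rewrite -normsq_eq0.
by apply: (implyP (h q _)); rewrite ?mem_index_enum.
Qed.

Lemma rownormsq_adj n (v : 'rV[R[i]]_n) :
  (v *m adjmx v) 0 0 = ((rownormsq v)%:C)%C.
Proof.
rewrite mxE rmorph_sum; apply: eq_bigr => q _.
by rewrite !mxE /= -mulcJ_normsq.
Qed.

Lemma adjmxM m n p (A : 'M[R[i]]_(m, n)) (B : 'M[R[i]]_(n, p)) :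
  adjmx (A *m B) = adjmx B *m adjmx A.
Proof. by rewrite /adjmx map_mxM trmx_mul. Qed.

Lemma adjmxK m n (A : 'M[R[i]]_(m, n)) : adjmx (adjmx A) = A.
Proof. by apply/matrixP => i j; rewrite !mxE conjCK. Qed.

Lemma gram_rownormsq n (A : 'M[R[i]]_n) (v : 'rV[R[i]]_n) :
  (v *m (A *m adjmx A) *m adjmx v) 0 0 = ((rownormsq (v *m A))%:C)%C.
Proof. by rewrite -rownormsq_adj adjmxM !mulmxA. Qed.

(** An eigenvalue is the Rayleigh quotient of its eigenvector, here a ratio of squared norms. *)
Lemma gram_eigenvalue_ge0 n (A : 'M[R[i]]_n) a :
  eigenvalue (adjmx A *m A) a -> exists2 r : R, 0 <= r & a = (r%:C)%C.
Proof.
move=> /eigenvalueP[v vA v0].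
have := gram_rownormsq (adjmx A) v; rewrite adjmxK vA -scalemxAl mxE rownormsq_adj.
have p : 0 < rownormsq v by rewrite lt_def rownormsq_ge0 rownormsq_eq0 v0.
move=> e; exists (rownormsq (v *m adjmx A) / rownormsq v).
  by rewrite divr_ge0 ?rownormsq_ge0.
rewrite rmorphM fmorphV /= -e mulfK //.
by apply/eqP => -[] /eqP; rewrite gt_eqF.
Qed.

(** Rayleigh's principle: in a unitary eigenbasis the quotient of [v] is a weighted mean of the
    eigenvalues. *)
Lemma gram_small_eigenvalue n (A : 'M[R[i]]_n) (v : 'rV[R[i]]_n) (c : R) :
  v != 0 -> rownormsq (v *m A) <= c * rownormsq v ->
  exists2 a, eigenvalue (A *m adjmx A) a & a <= (c%:C)%C.
Proof.
move=> v0 hv; set G := A *m adjmx A.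
have hG : G \is hermsymmx.
  apply/is_hermitianmxP; rewrite expr0 scale1r.
  transitivity (adjmx G); first by rewrite /G adjmxM adjmxK.
  by rewrite /adjmx map_trmx.
have /orthomx_spectralP := hermitian_normalmx hG.
have hreal := hermitian_spectral_diag_real hG.
set P := spectralmx G; set sp := spectral_diag G => GE.
have uP : P \in unitmx by apply: spectral_unit.
have PV : invmx P = adjmx P.
  by rewrite (invmx_unitary (spectral_unitarymx G)) /adjmx map_trmx.
case: (pselect (exists i, sp 0 i <= (c%:C)%C)) => [[i hi]|hall].
  exists (sp 0 i) => //; apply/eigenvalueP; exists (row i P).
    rewrite GE -row_mul !mulmxA mulmxV // mul1mx.
    by apply/rowP => j; rewrite !mxE (bigD1 i) //= big1 ?addr0 ?mxE ?eqxx // => k ki; rewrite mxE eq_sym (negbTE ki) mul0r.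
  apply/eqP => r0; have : row i P *m invmx P = 0 by rewrite r0 mul0mx.
  rewrite -row_mul mulmxV // => /rowP /(_ i).
  by rewrite !mxE eqxx => /eqP; rewrite oner_eq0.
(* Otherwise all eigenvalues exceed [c], and a nonzero coordinate of [u] makes the weighted sum
   strictly larger than c |u|^2. *)
exfalso; pose u := v *m adjmx P.
have nu : rownormsq u = rownormsq v.
  apply: complexI; rewrite -!rownormsq_adj /u adjmxM adjmxK !mulmxA.
  by rewrite -(mulmxA v) -PV mulVmx // mulmx1.
have u0 : 0 < rownormsq u by rewrite nu lt_def rownormsq_ge0 rownormsq_eq0 v0.
have rsp i : sp 0 i = ((Re (sp 0 i))%:C)%C.
  by rewrite RRe_real //; move/mxOverP: hreal; apply.
have hsp i : c < Re (sp 0 i).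
  by rewrite ltNge; apply/negP => h; apply: hall; exists i; rewrite rsp lecR.
have := gram_rownormsq A v; rewrite -/G GE PV.
have -> : v *m (adjmx P *m diag_mx sp *m P) *m adjmx v = u *m diag_mx sp *m adjmx u.
  by rewrite /u adjmxM adjmxK !mulmxA.
have -> : (u *m diag_mx sp *m adjmx u) 0 0 = ((\sum_(i < n) Re (sp 0 i) * normsq (u 0 i))%:C)%C.
  rewrite mul_mx_diag mxE rmorph_sum; apply: eq_bigr => i _.
  by rewrite !mxE rsp /= rmorphM /= -mulcJ_normsq mulrAC mulrC.
move=> /complexI h.
have : c * rownormsq u < \sum_(i < n) Re (sp 0 i) * normsq (u 0 i).
  rewrite mulr_sumr.
  have [i hi] : exists i, normsq (u 0 i) != 0.
    apply/existsP; rewrite -negb_forall; apply: contraL (u0) => /forallP h0.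
    by rewrite /rownormsq big1 ?ltxx // => i _; apply/eqP.
  rewrite (bigD1 i) //= [ltRHS](bigD1 i) //=.
  apply: ltr_leD.
    by rewrite ltr_pM2r // lt_def hi normsq_ge0.
  by apply: ler_sum => k _; rewrite ler_wpM2r ?normsq_ge0 // ltW.
by rewrite h nu ltNge hv.
Qed.

(** The default value of [xget] is never taken: [R[i]] is algebraically closed and n > 0, so
    eigenvalues exist; all are real, and the least real part among the finitely many roots of the
    characteristic polynomial is attained. *)
Lemma lambda_min_gramP n (A : 'M[R[i]]_n) : (0 < n)%N ->
  let H := adjmx A *m A in
  eigenvalue H ((lambda_min H)%:C)%C /\
  forall a, eigenvalue H a -> ((lambda_min H)%:C)%C <= a.
Proof.
move=> n0 H.
pose Q : set R := [set l : R | eigenvalue H ((l%:C)%C) /\ forall a, eigenvalue H a -> (l%:C)%C <= a].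
suff : Q (xget 0 Q) by [].
apply: xgetPex.
have [a0 ha0] := eigenvalue_closed H n0.
have [r hr] := closed_field_poly_normal (char_poly H).
have mem a : eigenvalue H a = (a \in r).
  rewrite eigenvalue_root_char hr (monicP (char_poly_monic H)) scale1r.
  by rewrite root_prod_XsubC.
have [m mr hm] : exists2 m, m \in map (@complex.Re R) r & forall y, y \in map (@complex.Re R) r -> m <= y.
  apply: (@seq_min_exists _ R _ (Re a0)); apply: map_f; by rewrite -mem.
exists m; split.
  case/mapP: mr => a; rewrite -mem => ha ->.
  by have [x _ e] := gram_eigenvalue_ge0 ha; move: ha; rewrite e.
move=> a ha; have [x _ e] := gram_eigenvalue_ge0 ha.
by rewrite e lecR hm //; apply/mapP; exists a; rewrite -?mem // e.
Qed.

Lemma lambda_min_gram_le n (A : 'M[R[i]]_n) (v : 'rV[R[i]]_n) (c : R) :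
  v != 0 -> rownormsq (v *m A) <= c * rownormsq v ->
  lambda_min (adjmx A *m A) <= c.
Proof.
move=> v0 hv; have n0 : (0 < n)%N.
  by case: n v v0 {A hv} => // v; rewrite [v]thinmx0 eqxx.
have [a /eigenvalue_mulmxC ha hac] := gram_small_eigenvalue v0 hv.
by rewrite -lecR; apply: le_trans hac; apply: (lambda_min_gramP A n0).2.
Qed.

End GramMatrix.

(** * Measurability of the smallest eigenvalue *)

(** Each factor is X plus a positive constant, and multiplying by it preserves positivity of the
    coefficients up to the degree. *)
Lemma coef_prod_XsubC_neg (F : numDomainType) (r : seq F) :
  (forall z, z \in r -> z < 0) -> forall k,
  0 <= (\prod_(z <- r) ('X - z%:P))`_k /\
  ((k <= size r)%N -> 0 < (\prod_(z <- r) ('X - z%:P))`_k).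
Proof.
elim: r => [|z r IH] hz k.
  rewrite big_nil coefC /=; case: k => [|k] /=; first by split.
  by split.
have z0 : z < 0 by apply: hz; rewrite mem_head.
have {}IH := IH (fun t tr => hz t (@mem_behead _ (z :: r) t tr)).
rewrite big_cons mulrBl coefB coefXM coefCM -mulNr.
have nz : 0 < - z by rewrite oppr_gt0.
case: k => [|k] /=.
  have [_ /(_ isT) h] := IH 0%N.
  by rewrite add0r; split=> [|_]; rewrite ?mulr_ge0 ?mulr_gt0 // ltW.
have [h0 h] := IH k; have [h1 h2] := IH k.+1; split.
  by rewrite addr_ge0 // mulr_ge0 // ltW.
by rewrite ltnS => /h hk; rewrite ltr_wpDr // mulr_ge0 // ltW.
Qed.

Section ComplexMeasurability.
Context (R : realType) (d : measure_display) (T : measurableType d).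
Implicit Types (f g : T -> R[i]) (p : T -> {poly R[i]}).

Definition measurable_cplx f :=
  measurable_fun setT (fun w => Re (f w)) /\ measurable_fun setT (fun w => Im (f w)).

Lemma measurable_cplx_cst (c : R[i]) : measurable_cplx (fun=> c).
Proof. by split; apply: measurable_cst. Qed.

Lemma measurable_cplxD f g : measurable_cplx f -> measurable_cplx g ->
  measurable_cplx (fun w => f w + g w).
Proof.
move=> [f1 f2] [g1 g2]; split.
  rewrite (_ : (fun _ => _) = (fun w => Re (f w) + Re (g w))); first exact: measurable_funD.
  by apply/funext => w; case: (f w) (g w) => ? ? [].
rewrite (_ : (fun _ => _) = (fun w => Im (f w) + Im (g w))); first exact: measurable_funD.
by apply/funext => w; case: (f w) (g w) => ? ? [].
Qed.

Lemma measurable_cplxM f g : measurable_cplx f -> measurable_cplx g ->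
  measurable_cplx (fun w => f w * g w).
Proof.
move=> [f1 f2] [g1 g2]; split.
  rewrite (_ : (fun _ => _) = (fun w => Re (f w) * Re (g w) - Im (f w) * Im (g w))).
    by apply: measurable_funB; apply: measurable_funM.
  by apply/funext => w; case: (f w) (g w) => ? ? [].
rewrite (_ : (fun _ => _) = (fun w => Re (f w) * Im (g w) + Im (f w) * Re (g w))).
  by apply: measurable_funD; apply: measurable_funM.
by apply/funext => w; case: (f w) (g w) => ? ? [].
Qed.

Lemma measurable_cplxJ f : measurable_cplx f -> measurable_cplx (fun w => ((f w)^*)%C).
Proof.
move=> [f1 f2]; split.
  by rewrite (_ : (fun _ => _) = (fun w => Re (f w))) //; apply/funext => w; case: (f w).
rewrite (_ : (fun _ => _) = (fun w => 0 - Im (f w))).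
  by apply: measurable_funB => //; apply: measurable_cst.
by apply/funext => w; rewrite sub0r; case: (f w).
Qed.

Lemma measurable_cplx_sum (I : Type) (r : seq I) (F : I -> T -> R[i]) :
  (forall i, measurable_cplx (F i)) -> measurable_cplx (fun w => \sum_(i <- r) F i w).
Proof.
move=> hF; elim: r => [|i r IH].
  by rewrite (_ : (fun _ => _) = fun=> 0); [exact: measurable_cplx_cst|apply/funext => w; rewrite big_nil].
rewrite (_ : (fun _ => _) = (fun w => F i w + \sum_(j <- r) F j w)); first exact: measurable_cplxD.
by apply/funext => w; rewrite big_cons.
Qed.

Lemma measurable_cplx_gt0 f : measurable_cplx f -> measurable [set w | 0 < f w].
Proof.
move=> [f1 f2].
have -> : [set w | 0 < f w] =
    ((fun w => Re (f w)) @^-1` `]0, +oo[%classic) `&` ((fun w => Im (f w)) @^-1` [set 0]).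
  apply/seteqP; split=> w /=; rewrite ltcE /= in_itv /= andbT.
    by move=> /andP[/eqP -> ->].
  by move=> [-> ->]; rewrite eqxx.
apply: measurableI; rewrite -[X in measurable X]setTI.
  by apply: f1 => //; exact: measurable_itv.
by apply: f2 => //; exact: measurable_set1.
Qed.

Definition measurable_poly p := forall k, measurable_cplx (fun w => (p w)`_k).

Lemma measurable_poly_cst (q : {poly R[i]}) : measurable_poly (fun=> q).
Proof. by move=> k; apply: measurable_cplx_cst. Qed.

Lemma measurable_polyC f : measurable_cplx f -> measurable_poly (fun w => (f w)%:P).
Proof.
move=> hf k; rewrite (_ : (fun _ => _) = (fun w => if k == 0%N then f w else 0)).
  by case: eqP => // _; apply: measurable_cplx_cst.
by apply/funext => w; rewrite coefC.
Qed.

Lemma measurable_polyD p q : measurable_poly p -> measurable_poly q ->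
  measurable_poly (fun w => p w + q w).
Proof.
move=> hp hq k; rewrite (_ : (fun _ => _) = (fun w => (p w)`_k + (q w)`_k)).
  exact: measurable_cplxD.
by apply/funext => w; rewrite coefD.
Qed.

Lemma measurable_polyM p q : measurable_poly p -> measurable_poly q ->
  measurable_poly (fun w => p w * q w).
Proof.
move=> hp hq k.
rewrite (_ : (fun _ => _) = (fun w => \sum_(j < k.+1) (p w)`_j * (q w)`_(k - j))).
  by apply: measurable_cplx_sum => j; apply: measurable_cplxM.
by apply/funext => w; rewrite coefM.
Qed.

Lemma measurable_poly_sum (I : Type) (r : seq I) (F : I -> T -> {poly R[i]}) :
  (forall i, measurable_poly (F i)) -> measurable_poly (fun w => \sum_(i <- r) F i w).
Proof.
move=> hF; elim: r => [|i r IH].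
  by rewrite (_ : (fun _ => _) = fun=> 0); [exact: measurable_poly_cst|apply/funext => w; rewrite big_nil].
rewrite (_ : (fun _ => _) = (fun w => F i w + \sum_(j <- r) F j w)); first exact: measurable_polyD.
by apply/funext => w; rewrite big_cons.
Qed.

Lemma measurable_poly_prod (I : Type) (r : seq I) (F : I -> T -> {poly R[i]}) :
  (forall i, measurable_poly (F i)) -> measurable_poly (fun w => \prod_(i <- r) F i w).
Proof.
move=> hF; elim: r => [|i r IH].
  by rewrite (_ : (fun _ => _) = fun=> 1); [exact: measurable_poly_cst|apply/funext => w; rewrite big_nil].
rewrite (_ : (fun _ => _) = (fun w => F i w * \prod_(j <- r) F j w)); first exact: measurable_polyM.
by apply/funext => w; rewrite big_cons.
Qed.

(** The Leibniz formula builds the polynomial from the entries by sums and products. *)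
Lemma measurable_char_poly n (M : T -> 'M[R[i]]_n) :
  (forall i j, measurable_cplx (fun w => M w i j)) ->
  measurable_poly (fun w => char_poly (M w)).
Proof.
move=> hM; rewrite /char_poly /determinant.
apply: measurable_poly_sum => s; apply: measurable_polyM; first exact: measurable_poly_cst.
apply: measurable_poly_prod => i.
move: (perm.fun_of_perm.body s i) => j.
rewrite (_ : (fun _ => _) = (fun w => ('X *+ (i == j)) + (- M w i j)%:P)).
  apply: measurable_polyD; first exact: measurable_poly_cst.
  apply: measurable_polyC.
  rewrite (_ : (fun _ => _) = (fun w => -1 * M w i j)).
    by apply: measurable_cplxM => //; apply: measurable_cplx_cst.
  by apply/funext => w; rewrite mulN1r.
by apply/funext => w; rewrite !mxE polyCN.
Qed.

End ComplexMeasurability.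

(** The roots of the polynomial are c minus the eigenvalues of [H]. If all are negative, the
    coefficients are positive; conversely a polynomial with positive coefficients has no root >= 0.
    The event thus becomes finitely many inequalities on polynomials in the entries, whence
    measurability. *)
Lemma lambda_min_gram_gtP (R : realType) n (A : 'M[R[i]]_n) (c : R) : (0 < n)%N ->
  let H := adjmx A *m A in
  (c < lambda_min H) <->
  (forall k, (k <= n)%N -> 0 < (char_poly (((c%:C)%C)%:M - H))`_k).
Proof.
move=> n0 H; have [hl hmin] := lambda_min_gramP A n0; rewrite -/H in hl hmin.
set Q := char_poly _.
have eigE a : eigenvalue (((c%:C)%C)%:M - H) a = eigenvalue H ((c%:C)%C - a).
  apply/eigenvalueP/eigenvalueP => -[v vv v0]; exists v => //.
    move: vv; rewrite mulmxBr mul_mx_scalar scalerBl => <-.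
    by rewrite opprB addrC subrK.
  by rewrite mulmxBr mul_mx_scalar vv scalerBl opprB addrC subrK.
split=> [hc k kn|hk].
  have [r hr] := closed_field_poly_normal Q.
  move: hr; rewrite (monicP (char_poly_monic _)) scale1r => hr.
  have sr : size r = n.
    by apply: succn_inj; rewrite -(size_prod_XsubC r id) -hr size_char_poly.
  rewrite hr; apply: (coef_prod_XsubC_neg _ k).2; last by rewrite sr.
  move=> z zr; have : eigenvalue H ((c%:C)%C - z).
    by rewrite -eigE eigenvalue_root_char -/Q hr root_prod_XsubC.
  move=> /hmin h; rewrite -subr_gt0 sub0r -(ltrD2l (c%:C)%C) addr0.
  by apply: lt_le_trans h; rewrite ltcR.
rewrite ltNge; apply/negP => hle.
have : eigenvalue (((c%:C)%C)%:M - H) (((c - lambda_min H)%:C)%C).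
  by rewrite eigE rmorphB opprB addrC subrK.
rewrite eigenvalue_root_char -/Q => /rootP; apply/eqP.
rewrite horner_coef size_char_poly gt_eqF // big_ord_recl /=.
apply: ltr_wpDr; last by rewrite expr0 mulr1 hk.
apply: sumr_ge0 => k _; rewrite mulr_ge0 ?exprn_ge0 //.
  by apply/ltW/hk; rewrite /bump /= add1n ltn_ord.
by rewrite ler0c subr_ge0.
Qed.

Lemma measurable_lambda_min_le (R : realType) (d : measure_display)
  (T : measurableType d) n (theta : 'I_n -> T -> R) (c : R) : (0 < n)%N ->
  (forall q, measurable_fun setT (theta q)) ->
  let V w := vandermonde (fun q => theta q w) in
  measurable [set w | lambda_min (adjmx (V w) *m V w) <= c].
Proof.
move=> n0 mtheta V.
have -> : [set w | lambda_min (adjmx (V w) *m V w) <= c] =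
    ~` \bigcap_(k in [set k | (k <= n)%N])
      [set w | 0 < (char_poly (((c%:C)%C)%:M - adjmx (V w) *m V w))`_k].
  apply/seteqP; split=> w /=.
    by move=> h h2; have := (lambda_min_gram_gtP (V w) c n0).2 h2; rewrite ltNge h.
  move=> h; rewrite leNgt; apply/negP => /(lambda_min_gram_gtP (V w) c n0).1 h2.
  by apply: h => k; apply: h2.
apply: measurableC; apply: bigcap_measurableType => k _.
apply: measurable_cplx_gt0.
apply: (@measurable_char_poly R d T n (fun w => ((c%:C)%C)%:M - adjmx (V w) *m V w)) => i j.
have mV a b : measurable_cplx (fun w => V w a b).
  have mt : measurable_fun setT (fun w => 2 * pi * a%:R * theta b w).
    by apply: measurable_funM => //; apply: measurable_cst.
  split.
    rewrite (_ : (fun _ => _) = (fun w => (Num.sqrt (n%:R))^-1 * cos (2 * pi * a%:R * theta b w))).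
      apply: measurable_funM; first exact: measurable_cst.
      apply: measurableT_comp mt.
      by apply: continuous_measurable_fun; exact: continuous_cos.
    by apply/funext => w; rewrite mxE.
  rewrite (_ : (fun _ => _) = (fun w => (Num.sqrt (n%:R))^-1 * sin (2 * pi * a%:R * theta b w))).
    apply: measurable_funM; first exact: measurable_cst.
    apply: measurableT_comp mt.
    by apply: continuous_measurable_fun; exact: continuous_sin.
  by apply/funext => w; rewrite mxE.
rewrite (_ : (fun _ => _) = (fun w => ((c%:C)%C)%:M i j + -1 * \sum_(q < n) ((V w q i)^*)%C * V w q j)).
  apply: measurable_cplxD; first exact: measurable_cplx_cst.
  apply: measurable_cplxM; first exact: measurable_cplx_cst.
  by apply: measurable_cplx_sum => q; apply: measurable_cplxM => //; apply: measurable_cplxJ.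
apply/funext => w; rewrite !mxE mulN1r; congr (_ - _).
by apply: eq_bigr => q _; rewrite !mxE.
Qed.

(** * Numerical estimates *)

Section Numerics.
Import numFieldNormedType.Exports.
Variable R : realType.

(** Half-angle formulas with C = cos(pi/4) = sin(pi/4): sqrt 2 = 2 C, sin(pi/8)^2 = (1 - C) / 2 and
    2 sin(pi/8) cos(pi/8) = C. *)
Lemma cot_piquarter_half : cos (pi / 8) / sin (pi / 8) = 1 + Num.sqrt 2 :> R.
Proof.
have p0 := @pi_gt0 R.
have s0 : 0 < sin (pi / 8 : R) by apply: sin_gt0_pihalf; lra.
have e : (pi / 8 : R) *+ 2 = pi / 4 by rewrite mulr2n; lra.
have c4 : 0 < cos (pi / 4 : R) by apply: cos_gt0_pihalf; lra.
have h1 : cos (pi / 4 : R) = sin (pi / 4).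
  have := @tan_piquarter R; rewrite /tan => /(congr1 (fun x => x * cos (pi / 4))).
  by rewrite divfK ?mul1r // lt0r_neq0.
have h2 := cos2Dsin2 (pi / 4 : R); rewrite -h1 in h2.
have := cos_mulr2n (pi / 8 : R); have := sin_mulr2n (pi / 8 : R); rewrite e -h1 => h3 h4.
have h5 := cos2Dsin2 (pi / 8 : R).
move: h2 h3 h4 h5 s0 c4; set C := cos (pi / 4); set c := cos _; set s := sin _.
rewrite !mulr2n => h2 h3 h4 h5 s0 c4.
have r2 : (Num.sqrt 2 : R) = 2 * C.
  by rewrite -[RHS]ger0_norm ?mulr_ge0 ?(ltW c4) // -sqrtr_sqr; congr Num.sqrt; nra.
rewrite r2; apply: (mulIf (lt0r_neq0 s0)); rewrite divfK ?lt0r_neq0 //.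
apply: (mulIf (lt0r_neq0 s0)).
have s2 : s * s = (1 - C) / 2 by nra.
by rewrite -mulrA s2; nra.
Qed.

Lemma gamma16_gt0 : 0 < gamma16 R.
Proof.
rewrite /gamma16 cot_piquarter_half ln_gt0 // ltrDl sqrtr_gt0; lra.
Qed.

(** Mean value theorem for g - p. Iterating it integrates crude bounds into one-sided Taylor
    bounds. *)
Lemma horner_le_of_derive (g dg : R -> R) (p : {poly R}) :
  (forall x : R, is_derive x (1 : R) g (dg x)) -> p.[0] = g 0 ->
  (forall x : R, 0 <= x -> p^`().[x] <= dg x) -> forall x : R, 0 <= x -> p.[x] <= g x.
Proof.
move=> gd p0 hp x x0.
pose F : R -> R := fun z => g z - p.[z].
have fd (y : R) : is_derive y (1 : R) F (dg y - p^`().[y]).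
  exact: is_deriveB (gd y) (is_derive_poly p y).
have cf : {within `[0, x], continuous F}.
  by apply: derivable_within_continuous => y _; apply: ex_derive; exact: fd.
have [c cx] := MVT_segment x0 (fun y _ => fd y) cf.
rewrite /F p0 subrr !subr0.
move: cx; rewrite in_itv /= => /andP[c0 _] h.
by rewrite -subr_ge0 h mulr_ge0 // subr_ge0 hp.
Qed.

Lemma expR_ge_taylor3 (x : R) : 0 <= x -> 1 + x + x ^+ 2 / 2 + x ^+ 3 / 6 <= expR x.
Proof.
have d (y : R) : is_derive y (1 : R) expR (expR y) by exact: is_derive_expR.
have k2 (y : R) : 0 <= y -> (1%:P + 'X + 2^-1 *: 'X^2 : {poly R}).[y] <= expR y.
  apply: (horner_le_of_derive d) => [|z _].
    by rewrite !hornerE /= ?oppr0 expR0; ring.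
  rewrite !(derivD, derivN, derivZ, derivXn, derivX, derivC) !hornerE /=; have := expR_ge1Dx z; lra.
have k3 (y : R) : 0 <= y -> (1%:P + 'X + 2^-1 *: 'X^2 + 6^-1 *: 'X^3 : {poly R}).[y] <= expR y.
  apply: (horner_le_of_derive d) => [|z /k2 h].
    by rewrite !hornerE /= ?oppr0 expR0; ring.
  rewrite !(derivD, derivN, derivZ, derivXn, derivX, derivC) !hornerE /=; move: h; rewrite !hornerE /=; lra.
by move=> /k3; rewrite !hornerE /=; lra.
Qed.

Lemma expRN_ge_taylor3 (x : R) : 0 <= x -> 1 - x + x ^+ 2 / 2 - x ^+ 3 / 6 <= expR (- x).
Proof.
have d (y : R) : is_derive y (1 : R) (fun t => expR (- t)) (- expR (- y)).
  have h := @is_derive1_comp R expR -%R y _ _ (is_derive_expR (- y)) (is_deriveNid y 1).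
  by apply: is_derive_eq; rewrite mulrN1.
have dN (y : R) : is_derive y (1 : R) (fun t => - expR (- t)) (expR (- y)).
  by rewrite -[X in is_derive _ _ _ X]opprK; exact: is_deriveN (d y).
have k2 (y : R) : 0 <= y -> ((- 1)%:P + 'X - 2^-1 *: 'X^2 : {poly R}).[y] <= - expR (- y).
  apply: (horner_le_of_derive dN) => [|z _].
    by rewrite !hornerE /= ?oppr0 expR0; ring.
  rewrite !(derivD, derivN, derivZ, derivXn, derivX, derivC) !hornerE /=; have := expR_ge1Dx (- z); lra.
have k3 (y : R) : 0 <= y -> (1%:P - 'X + 2^-1 *: 'X^2 - 6^-1 *: 'X^3 : {poly R}).[y] <= expR (- y).
  apply: (horner_le_of_derive d) => [|z /k2 h].
    by rewrite !hornerE /= ?oppr0 expR0; ring.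
  rewrite !(derivD, derivN, derivZ, derivXn, derivX, derivC) !hornerE /=; move: h; rewrite !hornerE /=; lra.
by move=> /k3; rewrite !hornerE /=; lra.
Qed.

Lemma gamma16_lt : gamma16 R < 9 / 10.
Proof.
rewrite /gamma16 cot_piquarter_half -ltr_expR lnK ?posrE; last first.
  by rewrite addr_gt0 // sqrtr_gt0.
(* At 9/10 the cubic equals 2.4265, just above 1 + 71/50. *)
apply: lt_le_trans (expR_ge_taylor3 _); last by lra.
have : Num.sqrt 2 < 71 / 50 :> R.
  by rewrite -[ltRHS]ger0_norm ?divr_ge0 // -sqrtr_sqr ltr_sqrt //; lra.
lra.
Qed.

Lemma expR1_lt : expR 1 < 137 / 50 :> R.
Proof.
(* The value of the cubic Taylor polynomial at 1/2; (48/29)^2 is slightly below 137/50. *)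
have h : 29 / 48 <= expR (- (1 / 2)) :> R.
  by have := @expRN_ge_taylor3 (1 / 2) _; lra.
have -> : expR 1 = expR (- (1 / 2)) ^- 2 :> R.
  by rewrite -expRM_natl -expRN; congr expR; field.
have t0 := expR_gt0 (- (1 / 2) : R).
by rewrite -[_^-1]mul1r ltr_pdivrMr ?exprn_gt0 //; nra.
Qed.

Lemma cos_ge_taylor2 (x : R) : 0 <= x -> 1 - x ^+ 2 / 2 <= cos x.
Proof.
have dc (y : R) : is_derive y (1 : R) cos (- sin y) by exact: is_derive_cos.
have dsN (y : R) : is_derive y (1 : R) (fun t => - sin t) (- cos y) by exact: is_deriveN.
have k1 (y : R) : 0 <= y -> (- 'X : {poly R}).[y] <= - sin y.
  apply: (horner_le_of_derive dsN) => [|z _]; first by rewrite sin0 !hornerE.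
  rewrite derivN derivX hornerN hornerC; have := cos_le1 z; lra.
have k2 (y : R) : 0 <= y -> (1%:P - 2^-1 *: 'X^2 : {poly R}).[y] <= cos y.
  apply: (horner_le_of_derive dc) => [|z /k1 h]; first by rewrite !hornerE /= cos0; ring.
  rewrite !(derivD, derivN, derivZ, derivXn, derivX, derivC) !hornerE /=.
  by move: h; rewrite !hornerE /=; lra.
by move=> /k2; rewrite !hornerE /=; lra.
Qed.

Lemma cos_le_taylor4 (x : R) : 0 <= x -> cos x <= 1 - x ^+ 2 / 2 + x ^+ 4 / 24.
Proof.
have ds (y : R) : is_derive y (1 : R) sin (cos y) by exact: is_derive_sin.
have dcN (y : R) : is_derive y (1 : R) (fun t => - cos t) (sin y).
  rewrite -[X in is_derive _ _ _ X]opprK.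
  by apply: is_deriveN; exact: is_derive_cos.
have k3 (y : R) : 0 <= y -> ('X - 6^-1 *: 'X^3 : {poly R}).[y] <= sin y.
  apply: (horner_le_of_derive ds) => [|z /cos_ge_taylor2 h].
    by rewrite !hornerE /= ?oppr0 sin0; ring.
  rewrite !(derivD, derivN, derivZ, derivXn, derivX, derivC) !hornerE /=; lra.
have k4 (y : R) : 0 <= y -> ((- 1)%:P + 2^-1 *: 'X^2 - 24^-1 *: 'X^4 : {poly R}).[y] <= - cos y.
  apply: (horner_le_of_derive dcN) => [|z /k3 h].
    by rewrite !hornerE /= ?oppr0 cos0; ring.
  rewrite !(derivD, derivN, derivZ, derivXn, derivX, derivC) !hornerE /=; move: h; rewrite !hornerE /=; lra.
by move=> /k4; rewrite !hornerE /=; lra.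
Qed.

Lemma pi_lt : pi < 16 / 5 :> R.
Proof.
rewrite ltNge; apply/negP => h.
(* If 8/5 <= pi/2 the cosine is nonnegative there, but the quartic upper bound is negative. *)
have : 0 <= cos (8 / 5 : R) by apply: cos_ge0_pihalf; have := @pi_gt0 R; lra.
have := @cos_le_taylor4 (8 / 5) _; lra.
Qed.

(* Squared, the last bound follows from [2 * D * expR (1 - 2 * D) <= 1] and
   [gamma16 R * pi * expR 1 < 8]. *)
Lemma small_ball_numeric (eps : R) : 0 < eps < 1 ->
  let D := gamma16 R * pi / 4 * eps ^+ 2 in
  [/\ 0 < D, D < 1 & D * expR (1 - D) < eps].
Proof.
move=> /andP[e0 e1] D; have g0 := gamma16_gt0; have p0 := @pi_gt0 R.
have g1 := gamma16_lt; have p1 := pi_lt; have E1 := expR1_lt; have E0 := expR_gt0 (1 : R).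
set c := gamma16 R * pi / 4.
have c0 : 0 < c by rewrite divr_gt0 ?mulr_gt0.
have cE : c * expR 1 < 2.
  have : gamma16 R * pi < 9 / 10 * (16 / 5) by nra.
  rewrite /c; set g := gamma16 R * pi => hg; nra.
have c1 : c < 1 by have := expR_ge1Dx (1 : R); nra.
have D0 : 0 < D by rewrite /D -/c mulr_gt0 // exprn_gt0.
split=> //; first by rewrite /D -/c; nra.
have h : 2 * D <= expR (2 * D - 1) by have := expR_ge1Dx (2 * D - 1); lra.
rewrite -(@ltr_pXn2r _ 2) ?nnegrE ?(mulr_ge0 (ltW D0) (expR_ge0 _)) ?(ltW e0) //.
rewrite exprMn -expRM_natl.
have -> : 2%:R * (1 - D) = 1 + - (2 * D - 1) by ring.
rewrite expRD expRN.
have q : 2 * D / expR (2 * D - 1) <= 1 by rewrite ler_pdivrMr ?expR_gt0 // mul1r.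
have -> : D ^+ 2 * (expR 1 / expR (2 * D - 1)) = (c * expR 1 / 2) * eps ^+ 2 * (2 * D / expR (2 * D - 1)).
  by rewrite /D -/c; field; rewrite lt0r_neq0 ?expR_gt0.
have e2 : 0 < eps ^+ 2 by rewrite exprn_gt0.
have k : c * expR 1 / 2 < 1 by lra.
have k0 : 0 < c * expR 1 / 2 by rewrite divr_gt0 ?mulr_gt0.
have q0 : 0 <= 2 * D / expR (2 * D - 1) by rewrite divr_ge0 ?expR_ge0 ?mulr_ge0 // ltW.
apply: (@le_lt_trans _ _ (c * expR 1 / 2 * eps ^+ 2)).
  by rewrite ler_piMr // mulr_ge0 // ltW.
by rewrite gtr_pMl.
Qed.

End Numerics.

(** * Deterministic bound on the smallest eigenvalue *)

Section PolynomialMaximum.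
Variable R : realType.

(** A maximum dominates a mean with nonnegative weights of sum 1, and [weighted_log_ge] bounds that
    mean root by root. *)
Lemma exists_large_root_product N (z : 'I_N -> R[i]) L (r : R) :
  (forall q, normsq (z q) = 1) -> (2 < L)%N -> 0 <= r < 1 ->
  let S := \sum_q z q in S != 0 ->
  exists zeta : R[i], [/\ normsq zeta <= 1, 0 < normsq (\prod_q (zeta - z q)) &
    r * normc S - N%:R * (4 * r ^+ (L - 2) / (1 - r)) <=
    ln (normsq (\prod_q (zeta - z q)))].
Proof.
move=> hz hL /andP[r0 r1] S S0.
have hr : 0 <= r < 1 by rewrite r0.
have L0 : (0 < L)%N by apply: leq_trans hL.
set w := cis (2 * pi / L%:R : R).
have nS0 : 0 < normc S by rewrite normcE sqrtr_gt0 lt_def normsq_ge0 normsq_eq0 S0.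
(* With this rotation the numbers [a q] sum to -|S|, so the main terms add up to r |S|. *)
pose c : R[i] := - S / ((normc S)%:C)%C.
have nS : normsq S = normc S ^+ 2 by rewrite normsqE.
have nc : normsq c = 1.
  rewrite /c -fmorphV normsqM normsqN normsq_real nS exprVn divff //.
  by rewrite expf_neq0 // lt0r_neq0.
pose a q : R[i] := ((z q)^*)%C * c.
have na q : normsq (a q) = 1 by rewrite normsqM normsqJ hz nc mulr1.
pose zeta (j : nat) : R[i] := (r%:C)%C * (c * w ^+ j).
have nw j : normsq (w ^+ j) = 1 by rewrite normsqX normsq_cis expr1n.
have nzw q j : normsq (zeta j - z q) = normsq (1 - (r%:C)%C * (a q * w ^+ j)).
  have -> : zeta j - z q = - z q * (1 - (r%:C)%C * (a q * w ^+ j)).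
    have e : z q * ((z q)^*)%C = 1 by rewrite mulcJ_normsq hz.
    rewrite /a -(mulrA _ c) mulrBr mulr1 mulNr opprK [(r%:C)%C * _]mulrCA [z q * _]mulrA e mul1r.
    exact: addrC.
  by rewrite normsqM normsqN hz mul1r.
have nzeta j : normsq (zeta j) = r ^+ 2.
  by rewrite /zeta normsqM (normsqM c) nc nw !mulr1 normsq_real.
(* Since r < 1, [zeta j] stays off the unit circle, where all the roots lie. *)
have pos q j : 0 < normsq (zeta j - z q).
  rewrite lt_def normsq_ge0 andbT normsq_eq0 subr_eq0; apply/eqP => e.
  by have := hz q; rewrite -e nzeta; nra.
have ln_prod j : ln (normsq (\prod_q (zeta j - z q))) =
    \sum_q ln (normsq (1 - (r%:C)%C * (a q * w ^+ j))).
  transitivity (\sum_q ln (normsq (zeta j - z q))); last by apply: eq_bigr => q _; rewrite nzw.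
  suff [_ ->] : 0 < normsq (\prod_q (zeta j - z q)) /\
     ln (normsq (\prod_q (zeta j - z q))) = \sum_q ln (normsq (zeta j - z q)) by [].
  elim/big_rec2: _ => [|q x y _ [y0 <-]]; first by rewrite normsq1 ln1.
  by rewrite normsqM mulr_gt0 // lnM ?posrE.
have posP j : 0 < normsq (\prod_q (zeta j - z q)).
  elim/big_rec: _ => [|q x _ y0]; first by rewrite normsq1.
  by rewrite normsqM mulr_gt0.
have tot : \sum_(j < L) circle_weight R L j = 1.
  apply: complexI; rewrite rmorph1 rmorph_sum /=.
  have := sum_circle_weightX R hL 0; rewrite dvdn0 add0n !gtnNdvd //; last 3 first.
  - by rewrite -ltnS prednK // ltnW.
  - by rewrite prednK.
  - exact: ltnW.
  rewrite addr0 mul0r addr0 mulr1n => <-; apply: eq_bigr => j _.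
  by rewrite expr0 expr1n mulr1.
have [j hj] : exists j : 'I_L, forall k : 'I_L,
    ln (normsq (\prod_q (zeta k - z q))) <= ln (normsq (\prod_q (zeta j - z q))).
  have j0 : 'I_L by exists 0%N.
  case: (@arg_maxP _ R _ j0 xpredT (fun k : 'I_L => ln (normsq (\prod_q (zeta k - z q))))) => // j _ h.
  by exists j => k; apply: h.
exists (zeta j); split=> //.
  by rewrite nzeta; nra.
apply: (@le_trans _ _ (\sum_(k < L) circle_weight R L k * ln (normsq (\prod_q (zeta k - z q))))); last first.
  apply: (@le_trans _ _ (\sum_(k < L) circle_weight R L k * ln (normsq (\prod_q (zeta j - z q))))).
    by apply: ler_sum => k _; rewrite ler_wpM2l ?circle_weight_ge0.
  by rewrite -mulr_suml tot mul1r.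
have -> : \sum_(k < L) circle_weight R L k * ln (normsq (\prod_q (zeta k - z q))) =
   \sum_q \sum_(k < L) circle_weight R L k * ln (normsq (1 - (r%:C)%C * (a q * w ^+ k))).
  by rewrite exchange_big; apply: eq_bigr => k _; rewrite ln_prod mulr_sumr.
apply: (@le_trans _ _ (\sum_(q < N) (- (r * Re (a q)) - 4 * r ^+ (L - 2) / (1 - r)))).
  rewrite big_split /= !sumrN -mulr_sumr sumr_const card_ord mulr_natl.
  rewrite lerD2r -mulrN ler_wpM2l //.
  rewrite -Re_sum -mulr_suml -rmorph_sum -/S /c.
  rewrite -fmorphV mulrA mulrN [_ * S]mulrC mulcJ_normsq nS -rmorphN -rmorphM /=.
  by rewrite mulNr opprK expr2 mulfK // lt0r_neq0.
by apply: ler_sum => q _; apply: weighted_log_ge.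
Qed.

End PolynomialMaximum.

Section VandermondeBound.
Variables (R : realType) (N : nat) (theta : 'I_N -> R).
Let z q : R[i] := cis (2 * pi * theta q).
Let V := vandermonde theta.

Lemma vandermondeE j q : V j q = (((Num.sqrt N%:R)^-1)%:C)%C * z q ^+ j.
Proof.
rewrite mxE -cisMn /z.
have -> : 2 * pi * j%:R * theta q = j%:R * (2 * pi * theta q) by ring.
by rewrite /cis; simpc.
Qed.

Lemma sum_sqr_le (f : 'I_N -> R) : (\sum_i f i) ^+ 2 <= N%:R * \sum_i f i ^+ 2.
Proof.
rewrite expr2 mulr_suml.
apply: (@le_trans _ _ (\sum_(i < N) \sum_(j < N) (f i ^+ 2 / 2 + f j ^+ 2 / 2))).
  apply: ler_sum => i _; rewrite mulr_sumr; apply: ler_sum => j _.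
  by have := sqr_ge0 (f i - f j); lra.
rewrite (eq_bigr (fun i => N%:R * (f i ^+ 2 / 2) + \sum_j f j ^+ 2 / 2)) => [|i _]; last first.
  by rewrite big_split /= sumr_const card_ord mulr_natl.
rewrite big_split /= -mulr_sumr sumr_const card_ord -mulr_suml.
rewrite -[(_ / 2) *+ N]mulr_natl -mulrDr -splitr.
exact: lexx.
Qed.

(* Row vector of coefficients of [\prod_q ('X - z q) - 'X^N]: this polynomial has
   degree < N and equals [- z q ^+ N], of modulus 1, at every node. *)
Lemma lambda_min_vandermonde_le (zeta : R[i]) : (0 < N)%N -> normsq zeta <= 1 ->
  4 <= normsq (\prod_q (zeta - z q)) ->
  lambda_min (adjmx V *m V) <= 4 * N%:R / normsq (\prod_q (zeta - z q)).
Proof.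
move=> N0 hzeta hM; set M := normsq _ in hM *.
have N0' : 0 < N%:R :> R by rewrite ltr0n.
pose P : {poly R[i]} := \prod_q ('X - (z q)%:P).
have sP : size P = N.+1
  by rewrite size_prod_XsubC /index_enum -enumT size_enum_ord.
have mP : P \is monic by apply: monic_prod_XsubC.
pose f := P - 'X^N.
have sf : (size f <= N)%N.
  apply/leq_sizeP => j; rewrite leq_eqVlt => /predU1P[<-|Nj].
    rewrite coefB coefXn eqxx -[N in P`_N]/(N.+1.-1) -sP -lead_coefE (monicP mP).
    by rewrite subrr.
  by rewrite coefB coefXn gtn_eqF // subr0 nth_default // sP.
have fE x : f.[x] = \sum_(j < N) f`_j * x ^+ j by apply: horner_coef_wide.
have PE x : P.[x] = \prod_q (x - z q).
  by rewrite horner_prod; apply: eq_bigr => q _; rewrite hornerXsubC.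
pose v : 'rV[R[i]]_N := \row_j f`_j.
have nv : M <= 4 * N%:R * rownormsq v.
  (* Triangle inequality with |zeta| <= 1, then Cauchy-Schwarz on the coefficients. *)
  have h1 : normc f.[zeta] ^+ 2 <= N%:R * rownormsq v.
    apply: le_trans (_ : (\sum_(j < N) normc f`_j) ^+ 2 <= _).
      have A : normc f.[zeta] <= \sum_(j < N) normc f`_j.
        rewrite fE; apply: le_trans (normc_sum _ _ _) _; apply: ler_sum => j _.
        rewrite normcM ler_piMr ?normc_ge0 //.
        by rewrite normcE normsqX -[leRHS]sqrtr1 ler_sqrt // exprn_ile1 ?normsq_ge0.
      apply: lerXn2r A; rewrite nnegrE ?normc_ge0 //.
      by apply: sumr_ge0 => j _; apply: normc_ge0.
    apply: le_trans (sum_sqr_le _) _; rewrite ler_wpM2l ?ler0n //.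
    by apply: ler_sum => j _; rewrite -normsqE mxE.
  have h2 : normc P.[zeta] <= normc f.[zeta] + 1.
    have -> : P.[zeta] = f.[zeta] + zeta ^+ N by rewrite hornerD hornerN hornerXn subrK.
    apply: le_trans (le_normcD _ _) _; rewrite lerD2l.
    by rewrite normcE normsqX -[leRHS]sqrtr1 ler_sqrt // exprn_ile1 ?normsq_ge0.
  have MP : M = normc P.[zeta] ^+ 2 by rewrite -normsqE PE.
  have p0 := normc_ge0 P.[zeta]; have f0 := normc_ge0 f.[zeta].
  (* From |P| >= 2 follows |P| - 1 >= |P| / 2; squaring produces the factor 4. *)
  have h3 : 2 <= normc P.[zeta] by rewrite MP in hM; nra.
  rewrite MP; nra.
have v0 : v != 0.
  rewrite -rownormsq_eq0; apply/eqP => e; move: nv; rewrite e mulr0; lra.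
have vV : rownormsq (v *m V) = 1.
  rewrite /rownormsq (eq_bigr (fun _ => N%:R^-1)) => [|q _].
    by rewrite sumr_const card_ord -[LHS]mulr_natr mulVf // lt0r_neq0.
  have -> : (v *m V) 0 q = (((Num.sqrt N%:R)^-1)%:C)%C * f.[z q].
    rewrite mxE fE mulr_sumr; apply: eq_bigr => j _.
    by rewrite vandermondeE mxE mulrCA.
  have -> : f.[z q] = - z q ^+ N.
    by rewrite hornerD hornerN hornerXn PE (bigD1 q) //= subrr mul0r sub0r.
  rewrite normsqM normsq_real normsqN normsqX normsq_cis expr1n mulr1 exprVn.
  by rewrite sqr_sqrtr ?ler0n.
apply: (lambda_min_gram_le v0); rewrite vV.
have M0 : 0 < M by lra.
by rewrite mulrAC ler_pdivlMr // mul1r.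
Qed.

(** The 2 in the exponent is made of two losses of at most 1: one from the radius r < 1, one from
    the error in r^(L-2). *)
Lemma lambda_min_vandermonde_le_expR : (1 < N)%N ->
  let S := \sum_q z q in 4 <= normc S ->
  lambda_min (adjmx V *m V) <= 4 * N%:R * expR (2 - normc S).
Proof.
move=> N1 S hS; have N0 : (0 < N)%N by apply: ltnW.
have N0' : 0 < N%:R :> R by rewrite ltr0n.
(* The radius loss is |S| / N <= 1, while 1 / (1 - r) is only N. *)
pose r : R := 1 - N%:R^-1.
have iN0 : 0 < (N%:R^-1 : R) by rewrite invr_gt0.
have iN1 : (N%:R^-1 : R) <= 1 by rewrite invf_le1 // ler1n.
have hr : 0 <= r < 1 by rewrite /r; apply/andP; split; lra.
have S0 : S != 0 by apply/eqP => e; move: hS; rewrite e normc0; lra.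
have SN : normc S <= N%:R.
  apply: le_trans (normc_sum _ _ _) _.
  by rewrite (eq_bigr (fun _ => 1)) => [|q _]; rewrite ?sumr_const ?card_ord // normc_cis.
have [k hk] : exists k, r ^+ k <= (4 * N%:R ^+ 2)^-1.
  (* Indeed (1 - 1/N)^(4 N^3) <= exp(-4 N^2) <= 1 / (4 N^2), which cancels the prefactor 4 N^2 of
     the error. *)
  exists (N * (4 * N ^ 2))%N.
  have e : 4 * N%:R ^+ 2 = (4 * N ^ 2)%N%:R :> R by rewrite natrM natrX.
  have p : 0 < 4 * N%:R ^+ 2 :> R by rewrite mulr_gt0 // exprn_gt0.
  apply: (@le_trans _ _ (expR (- N%:R^-1) ^+ (N * (4 * N ^ 2)))).
    apply: lerXn2r; rewrite ?nnegrE ?expR_ge0 //; first by case/andP: hr.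
    exact: expR_ge1Dx.
  rewrite -expRM_natl natrM -e mulrN mulrAC divff ?mul1r ?lt0r_neq0 // expRN.
  rewrite lef_pV2 ?posrE ?expR_gt0 //.
  by have := expR_ge1Dx (4 * N%:R ^+ 2 : R); lra.
have [zeta [hz hp]] := @exists_large_root_product R N z k.+3 r (fun q => normsq_cis _) isT hr S0.
rewrite -/S => hl.
have hl2 : normc S - 2 <= ln (normsq (\prod_q (zeta - z q))).
  apply: le_trans hl.
  have e1 : N%:R * (4 * r ^+ (k.+3 - 2) / (1 - r)) <= 1.
    have -> : 1 - r = N%:R^-1 by rewrite /r opprB addrC subrK.
    rewrite invrK.
    have hk1 : r ^+ (k.+3 - 2) <= (4 * N%:R ^+ 2)^-1.
      apply: le_trans hk; apply: ler_wiXn2l; first by case/andP: hr.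
        by case/andP: hr => _ /ltW.
      by rewrite subSS subSS subn0.
    have -> : N%:R * (4 * r ^+ (k.+3 - 2) * N%:R) = (4 * N%:R ^+ 2) * r ^+ (k.+3 - 2) :> R by ring.
    apply: le_trans (ler_wpM2l _ hk1) _; first by rewrite mulr_ge0 ?sqr_ge0.
    by rewrite divff // mulf_neq0 // expf_neq0 // lt0r_neq0.
  have e2 : r * normc S >= normc S - 1.
    rewrite /r mulrBl mul1r lerD2l lerN2 mulrC ler_pdivrMr // mul1r //.
  lra.
have hM : expR (normc S - 2) <= normsq (\prod_q (zeta - z q)).
  by rewrite -[leRHS]lnK ?posrE // ler_expR.
have h4 : 4 <= normsq (\prod_q (zeta - z q)).
  apply: le_trans hM.
  have h2 : 2 <= expR 1 :> R by have := expR_ge1Dx (1 : R); lra.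
  apply: (@le_trans _ _ (expR 2)); last by rewrite ler_expR; lra.
  have -> : expR 2 = expR 1 ^+ 2 :> R by rewrite -expRM_natl mulr1.
  nra.
apply: le_trans (lambda_min_vandermonde_le N0 hz h4) _.
rewrite ler_pM2l ?mulr_gt0 //.
have -> : 2 - normc S = - (normc S - 2) by ring.
by rewrite expRN lef_pV2 ?posrE ?expR_gt0.
Qed.

End VandermondeBound.

(** * Discretisation of independent uniform variables *)

Section GridProbability.
Context (R : realType) (d : measure_display) (T : measurableType d).
Variables (P : probability T R) (N m : nat) (theta : 'I_N -> {RV P >-> R}).
Hypothesis m_gt0 : (0 < m)%N.
Hypothesis theta_indep : mutually_independent P (fun q => (theta q : T -> R)).
Hypothesis theta_unif : forall q, uniform01 P (theta q).

(** Half-open, so that distinct cells are disjoint; those with k < m lie in [0, 1] and have mass 1 /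
    m. *)
Let cell (k : nat) : set R := `[k%:R / m%:R, k.+1%:R / m%:R[%classic.

Let box (f : {ffun 'I_N -> 'I_m}) : set T :=
  \bigcap_(q in [set q | q \in [set: 'I_N]%SET]) (theta q @^-1` cell (f q)).

Let m_gt0R : 0 < m%:R :> R. Proof. by rewrite ltr0n. Qed.

Lemma probability_cell q (k : 'I_m) : P (theta q @^-1` cell k) = (m%:R^-1)%:E.
Proof.
rewrite theta_unif; last exact: measurable_itv.
have -> : cell k `&` `[0, 1]%classic = cell k.
  apply/seteqP; split=> x /=; first by case.
  move=> h; split=> //; move: h; rewrite /cell /= !in_itv /= => /andP[h1 h2].
  rewrite (le_trans _ h1) ?divr_ge0 ?ler0n //= ltW // (lt_le_trans h2) //.
  by rewrite ler_pdivrMr // mul1r ler_nat.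
rewrite lebesgue_measure_itv /= lte_fin ltr_pM2r ?invr_gt0 // ltr_nat ltnSn.
by rewrite -EFinB -mulrBl -natrB // subSnn mul1r.
Qed.

Lemma measurable_box f : measurable (box f).
Proof.
apply: fin_bigcap_measurable => // q _; rewrite -[X in measurable X]setTI.
by apply: measurable_funP => //; exact: measurable_itv.
Qed.

Lemma probability_box f : P (box f) = ((m%:R ^+ N)^-1)%:E.
Proof.
have mc q : measurable (cell (f q)) by exact: measurable_itv.
rewrite /box (@theta_indep [set: 'I_N]%SET (fun q => cell (f q)) mc).
rewrite (eq_bigr (fun _ => (m%:R^-1)%:E)) => [|q _]; last exact: probability_cell.
rewrite prodEFin; congr EFin.
by rewrite prodr_const cardsT card_ord exprVn.
Qed.

Lemma box_disjoint f g w : box f w -> box g w -> f = g.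
Proof.
move=> hf hg; apply/ffunP => q; apply/val_inj/eqP.
have := hf q _; have := hg q _; rewrite /= inE => /(_ isT) + /(_ isT).
rewrite /cell /= !in_itv /= => /andP[g1 g2] /andP[f1 f2].
rewrite eqn_leq; apply/andP.
split; rewrite -ltnS -(ltr_nat R) -(@ltr_pM2r _ m%:R^-1) ?invr_gt0 //.
  exact: le_lt_trans f1 g2.
exact: le_lt_trans g1 f2.
Qed.

(** The boxes indexed by [A] are disjoint, lie in [E], and by independence have mass m^(-N) each. *)
Lemma probability_grid_ge (A : {pred {ffun 'I_N -> 'I_m}}) (E : set T) :
  measurable E ->
  (forall f w, f \in A ->
    (forall q, (f q)%:R / m%:R <= theta q w < (f q).+1%:R / m%:R) -> E w) ->
  ((#|A|%:R / m%:R ^+ N)%:E <= P E)%E.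
Proof.
move=> mE hE.
pose F (i : 'I_#|A|) := box (enum_val i).
pose G := \big[setU/set0]_(i < #|A|) F i.
have mF i : measurable (F i) by exact: measurable_box.
have PG : P G = (#|A|%:R / m%:R ^+ N)%:E.
  rewrite /G measure_bigsetU_ord //; last first.
    apply/trivIsetP => i j _ _; apply: contraNeq => /set0P[w [hi hj]].
    by apply/eqP/enum_val_inj; exact: box_disjoint hi hj.
  rewrite (eq_bigr (fun _ => ((m%:R ^+ N)^-1)%:E)) => [|i _]; last exact: probability_box.
  by rewrite sumEFin sumr_const card_ord mulr_natl.
rewrite -PG; apply: le_measure; rewrite ?inE //.
  by apply: bigsetU_measurable.
rewrite /G -bigcup_seq => w [i _ hw].
apply: (hE (enum_val i)); first exact: enum_valP.
by move=> q; have := hw q; rewrite /= inE => /(_ isT); rewrite /cell /= in_itv.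
Qed.

End GridProbability.

(** * Error of rounding the phases to the grid *)

Lemma normc_cisB (R : realType) (x y : R) : y <= x -> normc (cis x - cis y) <= x - y.
Proof.
move=> yx; have h : normsq (cis x - cis y) = 2 - 2 * cos (x - y).
  have c1 := cos2Dsin2 x; have c2 := cos2Dsin2 y; rewrite cosB /normsq /=.
  by move: c1 c2; set a := cos x; set b := sin x; set c := cos y; set e := sin y; nra.
have xy : 0 <= x - y by rewrite subr_ge0.
rewrite normcE -[leRHS]ger0_norm // -sqrtr_sqr ler_wsqrtr // h.
by have := cos_ge_taylor2 xy; lra.
Qed.

Lemma normc_grid_approx (R : realType) N m (theta : 'I_N -> R) (f : {ffun 'I_N -> 'I_m}) :
  (7 * N < m)%N ->
  (forall q, (f q)%:R / m%:R <= theta q < (f q).+1%:R / m%:R) ->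
  normc (grid_sum R f) - 1 <= normc (\sum_q cis (2 * pi * theta q)).
Proof.
move=> hm hf; have m0 : 0 < m%:R :> R by rewrite ltr0n; apply: leq_ltn_trans hm.
have p0 := @pi_gt0 R; have p4 := pi_lt R.
set S := \sum_q _.
have -> : grid_sum R f = S - (\sum_q (cis (2 * pi * theta q) - cis (2 * pi * ((f q)%:R / m%:R)))).
  rewrite sumrB opprB addrC subrK; apply: eq_bigr => q _; rewrite -cisMn.
  by congr cis; ring.
rewrite lerBlDr; apply: le_trans (le_normcD _ _) _; rewrite lerD2l normcN.
apply: le_trans (normc_sum _ _ _) _.
(* A phase moves by at most 1/m, hence its point by at most 2 pi / m <= 7 / m, as pi < 16/5; the
   total is at most 7 N / m <= 1. *)
apply: (@le_trans _ _ (\sum_(q < N) 7 / m%:R)).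
  apply: ler_sum => q _; have /andP[h1 h2] := hf q.
  apply: le_trans (normc_cisB _) _.
    by rewrite ler_pM2l ?mulr_gt0.
  rewrite -mulrBr.
  have h3 : theta q - (f q)%:R / m%:R <= m%:R^-1.
    rewrite lerBlDr; apply: ltW; apply: lt_le_trans h2 _.
    by rewrite -natr1 mulrDl mul1r addrC.
  have im : 0 < m%:R^-1 :> R by rewrite invr_gt0.
  have h4 : 0 <= theta q - (f q)%:R / m%:R by rewrite subr_ge0.
  nra.
rewrite sumr_const card_ord -[leLHS]mulr_natl mulrA ler_pdivrMr // mul1r.
by rewrite -natrM ler_nat mulnC ltnW.
Qed.

Theorem mainTheorem16 (R : realType) (eps : R) (heps : 0 < eps < 1) :
  exists N0 : nat, forall N : nat, (N0 <= N)%N ->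
  forall (d : measure_display) (T : measurableType d) (P : probability T R)
         (theta : 'I_N -> {RV P >-> R}),
    mutually_independent P (fun q => (theta q : T -> R)) ->
    (forall q, uniform01 P (theta q)) ->
    ((1 - eps)%:E <=
     P [set w : T | (lambda_min (adjmx (vandermonde (fun q => theta q w)) *m
                               vandermonde (fun q => theta q w))
                    <= 4 * (N%:R) ^+ 2 *
                       expR (- (Num.sqrt (gamma16 R * pi) * eps
                                * Num.sqrt (N%:R)) / 2))%R])%E.
Proof.
have [D0 D1 hD] := small_ball_numeric heps.
set D := gamma16 R * pi / 4 * eps ^+ 2 in D0 D1 hD.
have [e0 e1] := andP heps.
(* The Laplace parameter will be a = b / N: it satisfies 1 + a N = 1 / D and minimises exp(a D N) /
   (1 + a N). *)
pose b := D^-1 - 1.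
have b0 : 0 <= b by rewrite /b subr_ge0 invf_ge1 // ltW.
have DE0 : 0 < D * expR (1 - D) by rewrite mulr_gt0 ?expR_gt0.
(* Logarithmic margin between eps and the limiting bound D exp(1 - D). *)
pose l := ln (eps / (D * expR (1 - D))).
have l0 : 0 < l by rewrite ln_gt0 // ltr_pdivlMr // mul1r.
(* The error exponents 8 a^2 N^3 / n and 2 a, with n = N^2, add up to K / N. *)
pose K := 8 * b ^+ 2 + 2 * b.
have K0 : 0 <= K by rewrite addr_ge0 ?mulr_ge0 ?sqr_ge0.
(* The summands ensure, in order: sqrt(D N) >= 5; the smallness conditions on a; K / N <= l; and N >
   27 >= exp 3. *)
pose X := 25 / D + 4 * b + K / l + 27.
have X1 : 0 <= 25 / D by rewrite divr_ge0 // ltW.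
have X3 : 0 <= K / l by rewrite divr_ge0 // ltW.
have X0 : 0 <= X by rewrite /X; lra.
exists (Num.bound X) => N hN d T P theta hind hunif.
have XN : X < N%:R by apply: (lt_le_trans (archi_boundP X0)); rewrite ler_nat.
have N27 : 27 < N%:R :> R by apply: le_lt_trans XN; rewrite /X; lra.
have N0' : 0 < N%:R :> R by lra.
have N0 : (0 < N)%N by rewrite -(ltr_nat R).
have N1 : (1 < N)%N by rewrite -(ltr_nat R); lra.
set xN := Num.sqrt (D * N%:R).
have DN0 : 0 <= D * N%:R by rewrite mulr_ge0 // ltW.
have expE : - (Num.sqrt (gamma16 R * pi) * eps * Num.sqrt N%:R) / 2 = - xN.
  rewrite mulNr; congr (- _).
  have gp : 0 <= gamma16 R * pi by rewrite mulr_ge0 ?(ltW (gamma16_gt0 R)) ?pi_ge0.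
  rewrite -[LHS]ger0_norm ?divr_ge0 ?mulr_ge0 ?sqrtr_ge0 ?(ltW e0) //.
  rewrite -sqrtr_sqr /xN; congr Num.sqrt.
  by rewrite exprMn !exprMn !sqr_sqrtr ?ler0n // exprVn /D; field.
rewrite expE.
(* The grid approximation costs 1, which leaves the 4 required by the deterministic bound. *)
have x5 : 5 <= xN.
  rewrite -[5]ger0_norm // -sqrtr_sqr ler_wsqrtr //.
  have : 25 / D <= N%:R by apply: ltW; apply: le_lt_trans XN; rewrite /X; lra.
  rewrite ler_pdivrMr //; lra.
(* The degree n = N^2 makes the error of the exponential approximation vanish as N grows; [m]
   exceeds both n and 7 N. *)
pose n := (N ^ 2)%N; pose m := (N ^ 2 + 7 * N).+1.
have nm : (0 < n < m)%N by rewrite /n expn_gt0 N0 /= /m ltnS leq_addr.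
have m7 : (7 * N < m)%N by rewrite /m ltnS leq_addl.
have m0 : (0 < m)%N by [].
pose small := [pred f : {ffun 'I_N -> 'I_m} | normsq (grid_sum R f) <= D * N%:R].
pose A := [predC small].
set E := [set w : T | _].
have mE : measurable E.
  by apply: (measurable_lambda_min_le (theta := fun q => theta q)) => //.
have hA f w : f \in A -> (forall q, (f q)%:R / m%:R <= theta q w < (f q).+1%:R / m%:R) -> E w.
  rewrite inE /= -ltNge => hf hw; rewrite /E /=.
  have h1 := normc_grid_approx m7 hw.
  have h2 : xN < normc (grid_sum R f) by rewrite normcE ltr_sqrt // (le_lt_trans DN0).
  have h4 : 4 <= normc (\sum_q cis (2 * pi * theta q w)) by lra.
  apply: le_trans (lambda_min_vandermonde_le_expR N1 h4) _.
  (* The exponent 3 is the deterministic 2 plus the rounding loss 1; exp 3 is absorbed by one factor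
     N, whence N^2 in the theorem. *)
  have h3 : expR 3 <= 27 :> R.
    have -> : expR 3 = expR 1 ^+ 3 :> R by rewrite -expRM_natl mulr1.
    have E1 := expR1_lt R; have E0 := expR_gt0 (1 : R).
    apply: (@le_trans _ _ (3 ^+ 3)); last by rewrite -natrX.
    by apply: lerXn2r; rewrite ?nnegrE ?(ltW E0) //; lra.
  apply: (@le_trans _ _ (4 * N%:R * (expR 3 * expR (- xN)))).
    rewrite ler_wpM2l ?mulr_ge0 ?ler0n // -expRD ler_expR; lra.
  rewrite expr2 !mulrA ler_wpM2r ?expR_ge0 // ler_wpM2l ?mulr_ge0 ?ler0n //; lra.
apply: le_trans (probability_grid_ge m0 hind hunif mE hA).
rewrite lee_fin.
have mN0 : 0 < m%:R ^+ N :> R by rewrite exprn_gt0 // ltr0n.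
have cA : #|A|%:R = m%:R ^+ N - #|small|%:R :> R.
  apply/eqP; rewrite eq_sym subr_eq -natrD addnC cardC card_ffun !card_ord natrX //.
rewrite ler_pdivlMr // cA mulrBl mul1r lerD2l lerN2.
have ab : 0 <= b / N%:R <= 1 / 2.
  rewrite divr_ge0 ?ler0n //= ler_pdivrMr //; apply: ltW.
  apply: le_lt_trans (_ : X / 2 < _); first by rewrite /X; lra.
  by lra.
have n2R : n%:R = N%:R ^+ 2 :> R by rewrite natrX.
have hcond : 16 * (b / N%:R) ^+ 2 * N%:R ^+ 2 <= n%:R ^+ 2.
  have -> : 16 * (b / N%:R) ^+ 2 * N%:R ^+ 2 = (4 * b) ^+ 2 by field; rewrite lt0r_neq0.
  apply: lerXn2r; rewrite ?nnegrE ?mulr_ge0 ?ler0n // n2R.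
  have : 4 * b <= N%:R by apply: ltW; apply: le_lt_trans XN; rewrite /X; lra.
  nra.
apply: le_trans (small_grid_sum_card _ nm ab hcond) _.
rewrite mulrC ler_wpM2r ?(ltW mN0) //.
have -> : 1 + b / N%:R * N%:R = D^-1 by rewrite divfK ?lt0r_neq0 // /b addrC subrK.
rewrite invrK n2R.
have -> : 8 * (b / N%:R) ^+ 2 * N%:R ^+ 2 / N%:R ^+ 2 * N%:R + 2 * (b / N%:R) +
    b / N%:R * (D * N%:R) = K / N%:R + (1 - D).
  have bD : b * D = 1 - D by rewrite /b mulrBl mulVf ?lt0r_neq0 // mul1r.
  by rewrite -bD /K; field; rewrite lt0r_neq0.
rewrite expRD -mulrA [expR (1 - D) * D]mulrC -ler_pdivlMr //.
have -> : eps / (D * expR (1 - D)) = expR l by rewrite lnK // posrE divr_gt0.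
rewrite ler_expR ler_pdivrMr // mulrC -ler_pdivrMr //.
by apply: ltW; apply: le_lt_trans XN; rewrite /X; lra.
Qed.
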